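(* Let $\delta\ge 0$, $M\ge 0$, and let $(X,d)$ be an $M$-roughly starlike $\delta$-Gromov hyperbolic space. Fix a base point $p\in X$ and $\epsilon>0$, and let $X^{\epsilon}=(X,d_\epsilon)$ be the uniformized space. Then the following are equivalent: (1) the Gehring-Hayman property for metric boundary points holds for $X^\epsilon$; (2) the canonical boundary map $\Phi:\partial_G X\to\partial_{d_\epsilon}X^\epsilon$ is bijective and the Gehring-Hayman property for Gromov sequences holds for $X^\epsilon$; (3) the Gehring-Hayman theorem holds for $X^\epsilon$; (4) $X^\epsilon$ is a uniform space (i.e. $A$-uniform for some $A>0$).
   Context: For $x,y,p$ in a metric space $(X,d)$, the Gromov product is $(x|y)_p=\frac12(d(p,x)+d(p,y)-d(x,y))$. $(X,d)$ is $\delta$-Gromov hyperbolic if it is unbounded, proper, geodesic, and $(x|z)_p\ge \min\{(x|y)_p,(y|z)_p\}-\delta$ for all $x,y,z,p\in X$. $(X,d)$ is $M$-roughly starlike if there is a point $o\in X$ such that for every $x\in X$ there is a geodesic ray $\gamma:[0,\infty)\to X$ with $\gamma(0)=o$ and $\mathrm{dist}_d(x,\gamma)\le M$. Uniformization: for $\epsilon>0$ and base point $p$, set $\rho_\epsilon(z)=e^{-\epsilon d(p,z)}$ and $d_\epsilon(x,y)=\inf_\gamma\int_\gamma\rho_\epsilon\,ds$, infimum over all $d$-rectifiable curves from $x$ to $y$ (integral with respect to $d$-arclength). $X^\epsilon=(X,d_\epsilon)$; $l_{d_\epsilon}(\gamma)$ denotes the length of a curve with respect to $d_\epsilon$. The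 metric boundary is $\partial_{d_\epsilon}X^\epsilon=\overline{X^\epsilon}\setminus X^\epsilon$, closure in the completion. $[x,y]$ denotes a $d$-geodesic from $x$ to $y$. Gromov boundary $\partial_G X$: the set of geodesic rays $\gamma$ with $\gamma(0)=p$ modulo the equivalence $\gamma\sim\tilde\gamma$ iff $\sup_{t\ge0}d(\gamma(t),\tilde\gamma(t))<\infty$. The canonical boundary map $\Phi:\partial_GX\to\partial_{d_\epsilon}X^\epsilon$ sends $[\gamma]$ to the $d_\epsilon$-limit of $\gamma(k)$ as $k\to\infty$ (this limit exists and is independent of the representative). A Gromov sequence is $(x_n)\subseteq X$ with $(x_n|x_m)_p\to\infty$ as $n,m\to\infty$; two Gromov sequences $(x_n),(y_n)$ are equivalent if $(x_n|y_n)_p\to\infty$. The Gehring-Hayman theorem holds for $X^\epsilon$ if there is $A>0$ with $l_{d_\epsilon}([x,y])\le A\,d_\epsilon(x,y)$ for all $x,y\in X$ and every $d$-geodesic $[x,y]$. The Gehring-Hayman property for Gromov sequences holds if for each Gromov sequence $(x_n)$ there is $C\ge1$ (possibly depending on the sequence) with $l_{d_\epsilon}([x_n,x_m])\le C d_\epsilon(x_n,x_m)$ for all $n,m$. The Gehring-Hayman property for metric boundary points holds if for every $x\in\partial_{d_\epsilon}X^\epsilon$ and every sequence $(x_n)\subseteq X$ with $d_\epsilon(x_n,x)\to0$ there is $C\ge1$ with $l_{d_\epsilon}([x_n,x_m])\le Cd_\epsilon(x_n,x_m)$ for all $n,m$. For a metric space $(Y,\varrho)$ with metric boundary $\partial_\varrho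 Y=\overline Y\setminus Y$, a curve $\gamma:[a,b]\to Y$ is $A$-uniform if $l_\varrho(\gamma)\le A\varrho(\gamma(a),\gamma(b))$ and $\min\{l_\varrho(\gamma|_{[a,t]}),l_\varrho(\gamma|_{[t,b]})\}\le A\,\mathrm{dist}_\varrho(\gamma(t),\partial_\varrho Y)$ for all $t\in[a,b]$. A noncomplete locally compact metric space is $A$-uniform if every pair of points is joined by an $A$-uniform curve. *)

(* Defs.v *)
From Stdlib Require Import Reals.
From Coquelicot Require Import Coquelicot.
Open Scope R_scope.

Section Defs.
Context {X : Type}.

Definition is_metric (D : X -> X -> R) : Prop :=
  (forall x y, 0 <= D x y) /\
  (forall x y, D x y = 0 <-> x = y) /\
  (forall x y, D x y = D y x) /\
  (forall x y z, D x z <= D x y + D y z).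

Fixpoint sumlt (f : nat -> R) (n : nat) : R :=
  match n with O => 0 | S k => sumlt f k + f k end.

Definition is_partition (a b : R) (n : nat) (t : nat -> R) : Prop :=
  t O = a /\ t n = b /\ (forall i, (i < n)%nat -> t i <= t (S i)).

Definition is_curve (D : X -> X -> R) (g : R -> X) (a b : R) : Prop :=
  a <= b /\
  forall t, a <= t <= b -> forall e, 0 < e -> exists eta, 0 < eta /\
    forall s, a <= s <= b -> Rabs (s - t) < eta -> D (g s) (g t) < e.

Definition curve_length (D : X -> X -> R) (g : R -> X) (a b : R) : Rbar :=
  Lub_Rbar (fun s => exists n t, is_partition a b n t /\
     s = sumlt (fun i => D (g (t i)) (g (t (S i)))) n).

Definition rectifiable (D : X -> X -> R) (g : R -> X) (a b : R) : Prop :=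
  is_finite (curve_length D g a b).

(** Line integral  \int_g rho ds  (ds = D-arclength), defined as the
    (lower Darboux-)Riemann-Stieltjes integral of rho o g with respect to the
    arclength function of g: sup over partitions of
      sum_i (inf_{[t_i,t_{i+1}]} rho o g) * l_D(g|[t_i,t_{i+1}]).
    For nonnegative continuous rho and rectifiable g this is the usual
    arclength integral. *)
Definition inf_on (rho : X -> R) (g : R -> X) (u v : R) : R :=
  real (Glb_Rbar (fun r => exists s, u <= s <= v /\ r = rho (g s))).

Definition line_integral (D : X -> X -> R) (rho : X -> R) (g : R -> X)
  (a b : R) : Rbar :=
  Lub_Rbar (fun s => exists n t, is_partition a b n t /\
     s = sumlt (fun i => inf_on rho g (t i) (t (S i)) *
                         real (curve_length D g (t i) (t (S i)))) n).

Definition rho_eps (d : X -> X -> R) (p : X) (eps : R) (z : X) : R :=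
  exp (- eps * d p z).

Definition dist_eps (d : X -> X -> R) (p : X) (eps : R) (x y : X) : R :=
  real (Glb_Rbar (fun I => exists a b g, is_curve d g a b /\
     rectifiable d g a b /\ g a = x /\ g b = y /\
     line_integral d (rho_eps d p eps) g a b = Finite I)).

Definition is_geodesic (D : X -> X -> R) (g : R -> X) (x y : X) : Prop :=
  g 0 = x /\ g (D x y) = y /\
  forall s t, 0 <= s <= D x y -> 0 <= t <= D x y -> D (g s) (g t) = Rabs (s - t).

Definition is_ray (D : X -> X -> R) (g : R -> X) (o : X) : Prop :=
  g 0 = o /\ forall s t, 0 <= s -> 0 <= t -> D (g s) (g t) = Rabs (s - t).

Definition gromov_product (D : X -> X -> R) (p x y : X) : R :=
  (D p x + D p y - D x y) / 2.

Definition closed_ball_compact (D : X -> X -> R) (x : X) (r : R) : Prop :=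
  forall u : nat -> X, (forall n, D x (u n) <= r) ->
  exists (phi : nat -> nat) (z : X),
    (forall n, (phi n < phi (S n))%nat) /\ D x z <= r /\
    is_lim_seq (fun n => D (u (phi n)) z) 0.

Definition proper_space (D : X -> X -> R) : Prop :=
  forall x r, closed_ball_compact D x r.

Definition unbounded_space (D : X -> X -> R) : Prop :=
  forall x K, exists y, D x y > K.

Definition geodesic_space (D : X -> X -> R) : Prop :=
  forall x y, exists g, is_geodesic D g x y.

Definition gromov_hyperbolic (D : X -> X -> R) (delta : R) : Prop :=
  is_metric D /\ unbounded_space D /\ proper_space D /\ geodesic_space D /\
  forall x y z w, gromov_product D w x z >=
     Rmin (gromov_product D w x y) (gromov_product D w y z) - delta.

Definition roughly_starlike (D : X -> X -> R) (M : R) : Prop :=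
  exists o, forall x, exists g, is_ray D g o /\
    Rbar_le (Glb_Rbar (fun r => exists t, 0 <= t /\ r = D x (g t))) (Finite M).

(** Cauchy sequences; points of the metric boundary (closure of X in its
    completion, minus X) are represented by Cauchy sequences in X that do
    not converge in X. *)
Definition cauchy_seq (D : X -> X -> R) (u : nat -> X) : Prop :=
  forall e, 0 < e -> exists N, forall n m, (N <= n)%nat -> (N <= m)%nat ->
    D (u n) (u m) < e.

Definition converges_in (D : X -> X -> R) (u : nat -> X) : Prop :=
  exists z, is_lim_seq (fun n => D (u n) z) 0.

Definition boundary_seq (D : X -> X -> R) (xi : nat -> X) : Prop :=
  cauchy_seq D xi /\ ~ converges_in D xi.

Definition dist_to_bpt (D : X -> X -> R) (z : X) (xi : nat -> X) : R :=
  real (Lim_seq (fun m => D z (xi m))).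

Definition dist_to_boundary (D : X -> X -> R) (z : X) : Rbar :=
  Glb_Rbar (fun r => exists xi, boundary_seq D xi /\ r = dist_to_bpt D z xi).

Definition gromov_seq (d : X -> X -> R) (p : X) (u : nat -> X) : Prop :=
  forall K, exists N, forall n m, (N <= n)%nat -> (N <= m)%nat ->
    gromov_product d p (u n) (u m) >= K.

Definition GH_theorem (d de : X -> X -> R) : Prop :=
  exists A, 0 < A /\ forall x y g, is_geodesic d g x y ->
    Rbar_le (curve_length de g 0 (d x y)) (Finite (A * de x y)).

Definition GH_gromov_seq (d de : X -> X -> R) (p : X) : Prop :=
  forall u, gromov_seq d p u -> exists C, 1 <= C /\
    forall n m g, is_geodesic d g (u n) (u m) ->
      Rbar_le (curve_length de g 0 (d (u n) (u m))) (Finite (C * de (u n) (u m))).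

Definition GH_boundary_points (d de : X -> X -> R) : Prop :=
  forall xi, boundary_seq de xi ->
  forall u : nat -> X, is_lim_seq (fun n => dist_to_bpt de (u n) xi) 0 ->
  exists C, 1 <= C /\
    forall n m g, is_geodesic d g (u n) (u m) ->
      Rbar_le (curve_length de g 0 (d (u n) (u m))) (Finite (C * de (u n) (u m))).

(** The canonical map Phi : [gamma] |-> lim_de gamma(k) is bijective
    (rays are based at p; [gamma] = [gamma'] iff sup_t d(gamma t, gamma' t) < oo;
    boundary points are equal iff representing Cauchy sequences are
    de-asymptotic). *)
Definition Phi_bijective (d de : X -> X -> R) (p : X) : Prop :=
  (forall g g', is_ray d g p -> is_ray d g' p ->
     is_lim_seq (fun k => de (g (INR k)) (g' (INR k))) 0 ->
     exists C, forall t, 0 <= t -> d (g t) (g' t) <= C) /\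
  (forall xi, boundary_seq de xi ->
     exists g, is_ray d g p /\
       is_lim_seq (fun k => dist_to_bpt de (g (INR k)) xi) 0).

Definition uniform_curve (D : X -> X -> R) (A : R) (g : R -> X) (a b : R) : Prop :=
  is_curve D g a b /\
  Rbar_le (curve_length D g a b) (Finite (A * D (g a) (g b))) /\
  forall t, a <= t <= b ->
    Rbar_le (Rbar_min (curve_length D g a t) (curve_length D g t b))
            (Rbar_mult (Finite A) (dist_to_boundary D (g t))).

Definition noncomplete (D : X -> X -> R) : Prop := exists xi, boundary_seq D xi.

Definition locally_compact (D : X -> X -> R) : Prop :=
  forall x, exists r, 0 < r /\ closed_ball_compact D x r.

Definition uniform_space (D : X -> X -> R) : Prop :=
  noncomplete D /\ locally_compact D /\
  exists A, 0 < A /\ forall x y, exists g a b,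
    g a = x /\ g b = y /\ uniform_curve D A g a b.

End Defs.

(* Main.v *)
(** On a geodesic [x,y] the triangle inequality alone gives
    d(p, w) >= (x|y)_p + |w - w0|, where w0 is the point at distance
    d(p,x) - (x|y)_p from x, so that the d_eps-length of [x,y] is at most
    (2/eps) exp(-eps (x|y)_p); hyperbolicity gives d(p, w0) <= (x|y)_p + 2 delta,
    hence a matching lower bound once d(x,y) >= 1. Thus the Gehring-Hayman theorem
    amounts to d_eps(x,y) >= c exp(-eps (x|y)_p) for all x, y with d(x,y) > 1.

    (3) => (1) is immediate. (1) => (2): under (1) a sequence converging to a metric
    boundary point is a Gromov sequence, so two rays with the same image under Phi,
    interleaved, are equivalent. (2) => (3): pairs violating the bound ever more badly
    subconverge to two points of the Gromov boundary with equal images under Phi,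
    hence to one point, and interleaving them contradicts the property for Gromov
    sequences. (3) => (4): geodesics are uniform curves, since the d_eps-distance
    from z to the boundary is at least a constant times rho(z).

    (4) => (3): by rough starlikeness the distance from z to the boundary is at
    most C rho(z). Along a uniform curve choose points at consecutive d-distances
    comparable to 1; the d_eps-lengths of the initial pieces of the chain, up to the
    middle, and of its final pieces grow geometrically and dominate rho. Geometric
    growth beats the additive error of the four-point inequality, and
    exp(-eps (x|y)_p) is bounded by the total length of the chain. *)

Require Import Defs.
From Stdlib Require Import Reals Lra Lia Wf_nat Classical IndefiniteDescription.
From Coquelicot Require Import Coquelicot.
Open Scope R_scope.

Lemma exp_le_compat x y : x <= y -> exp x <= exp y.
Proof. intros [H|H]; [left; apply exp_increasing, H|right; f_equal; exact H]. Qed.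

Lemma real_Glb_Rbar_bounds (E : R -> Prop) (m x : R) :
  (forall y, E y -> m <= y) -> E x -> m <= Glb_Rbar E <= x.
Proof.
  intros Hm Hx. destruct (Glb_Rbar_correct E) as [Hlb Hglb].
  specialize (Hlb x Hx). specialize (Hglb (Finite m) Hm).
  destruct (Glb_Rbar E); simpl in *; tauto.
Qed.

Lemma Rbar_between_finite (x : Rbar) (a b : R) :
  Rbar_le a x -> Rbar_le x b -> is_finite x.
Proof. destruct x; simpl; try tauto. intros; reflexivity. Qed.

Lemma real_Rbar_bounds (x : Rbar) (a b : R) :
  Rbar_le a x -> Rbar_le x b -> a <= x <= b.
Proof. destruct x; simpl; tauto. Qed.

Lemma Rbar_mult_le_compat_l (A : R) (x y : Rbar) :
  0 < A -> Rbar_le x y -> Rbar_le (Rbar_mult A x) (Rbar_mult A y).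
Proof.
  intros HA H. destruct x, y; simpl in *; try nra; try tauto;
    destruct (Rle_dec 0 A) as [HA'|]; try lra;
    destruct (Rle_lt_or_eq_dec 0 A HA'); simpl; trivial; lra.
Qed.

Lemma sumlt_ext (f g : nat -> R) n :
  (forall i, (i < n)%nat -> f i = g i) -> sumlt f n = sumlt g n.
Proof. induction n; simpl; intros H; [easy|]. rewrite IHn, H; auto. Qed.

Lemma sumlt_le (f g : nat -> R) n :
  (forall i, (i < n)%nat -> f i <= g i) -> sumlt f n <= sumlt g n.
Proof. induction n; simpl; intros H; [lra|]. apply Rplus_le_compat; auto. Qed.

Lemma sumlt_plus (f g : nat -> R) n :
  sumlt (fun i => f i + g i) n = sumlt f n + sumlt g n.
Proof. induction n; simpl; [lra|]. rewrite IHn; lra. Qed.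

Lemma sumlt_telescope (f : nat -> R) n :
  sumlt (fun i => f (S i) - f i) n = f n - f O.
Proof. induction n; simpl; [lra|]. rewrite IHn; lra. Qed.

Lemma sumlt_cat (f : nat -> R) n m :
  sumlt f (n + m) = sumlt f n + sumlt (fun i => f (n + i)%nat) m.
Proof.
  induction m; simpl.
  - rewrite Nat.add_0_r; lra.
  - rewrite Nat.add_succ_r; simpl. rewrite IHm; lra.
Qed.

Lemma sumlt_first (f : nat -> R) n :
  sumlt f (S n) = f O + sumlt (fun i => f (S i)) n.
Proof. change (S n) with (1 + n)%nat. rewrite sumlt_cat. simpl. lra. Qed.

Lemma sumlt_rev (f : nat -> R) n :
  sumlt f n = sumlt (fun i => f (n - S i)%nat) n.
Proof.
  induction n; [easy|].
  rewrite (sumlt_first (fun i => f (S n - S i)%nat)).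
  simpl. rewrite IHn, Nat.sub_0_r. simpl. lra.
Qed.

Lemma sumlt_monotone (f : nat -> R) n i j :
  (forall k, (k < n)%nat -> 0 <= f k) -> (i <= j <= n)%nat -> sumlt f i <= sumlt f j.
Proof.
  intros Hf [Hij Hj]. induction Hij; [lra|]. simpl.
  specialize (IHHij ltac:(lia)). specialize (Hf m ltac:(lia)). lra.
Qed.

Lemma sumlt_nonneg (f : nat -> R) n :
  (forall k, (k < n)%nat -> 0 <= f k) -> 0 <= sumlt f n.
Proof. intros Hf. apply (sumlt_monotone f n 0 n Hf). lia. Qed.

Lemma sumlt_rev_partial (f : nat -> R) n k : (k <= n)%nat ->
  sumlt (fun i => f (n - S i)%nat) k = sumlt f n - sumlt f (n - k).
Proof.
  intros Hk. pose proof (sumlt_cat f (n - k) k) as H.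
  rewrite Nat.sub_add, (sumlt_rev (fun i => f (n - k + i)%nat)) in H by exact Hk.
  rewrite (sumlt_ext _ (fun i => f (n - k + (k - S i))%nat)); [lra|].
  intros i Hi. f_equal. lia.
Qed.

Lemma discrete_intermediate_value (f : nat -> R) n y : (0 < n)%nat -> f O <= y <= f n ->
  exists m, (m < n)%nat /\ f m <= y <= f (S m).
Proof.
  intros Hn Hy. induction n as [|n IH]; [lia|].
  destruct (Rle_dec (f n) y); [exists n; split; [lia|lra]|].
  destruct n as [|n]; [lra|]. destruct IH as (m & Hm & H); [lia|lra|].
  exists m. split; [lia|exact H].
Qed.

Lemma geometric_growth (s : nat -> R) q m i k : 0 <= q ->
  (forall j, (j < m)%nat -> q * s j <= s (S j)) -> (i + k <= m)%nat ->
  q ^ k * s i <= s (i + k)%nat.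
Proof.
  intros Hq Hs. induction k as [|k IH]; intros Hk.
  - rewrite Nat.add_0_r. simpl. lra.
  - rewrite Nat.add_succ_r. specialize (IH ltac:(lia)). specialize (Hs (i + k)%nat ltac:(lia)).
    apply Rle_trans with (q * s (i + k)%nat); trivial.
    simpl. rewrite Rmult_assoc. apply Rmult_le_compat_l; trivial.
Qed.

(** * Suprema over partitions *)

Lemma partition_le a b n t i j : is_partition a b n t ->
  (i <= j <= n)%nat -> t i <= t j.
Proof.
  intros (_ & _ & H) [Hij Hj]. induction Hij; [lra|].
  apply Rle_trans with (t m); [apply IHHij; lia|apply H; lia].
Qed.

Lemma partition_step a b n t i : is_partition a b n t -> (i < n)%nat ->
  a <= t i /\ t i <= t (S i) /\ t (S i) <= b.
Proof.
  intros H Hi.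
  pose proof (partition_le _ _ _ _ 0 i H ltac:(lia)) as Hleft.
  pose proof (partition_le _ _ _ _ (S i) n H ltac:(lia)) as Hright.
  destruct H as (H0 & Hn & Hm). rewrite H0 in Hleft. rewrite Hn in Hright. auto.
Qed.

Lemma partition_prefix a b n t k : is_partition a b n t -> (k <= n)%nat ->
  is_partition a (t k) k t.
Proof. intros (H0 & _ & Hm) Hk. repeat split; trivial. intros i Hi. apply Hm. lia. Qed.

Lemma partition_suffix a b n t k : is_partition a b n t -> (k <= n)%nat ->
  is_partition (t k) b (n - k) (fun i => t (k + i)%nat).
Proof.
  intros (_ & Hn & Hm) Hk. repeat split.
  - f_equal. lia.
  - rewrite <- Hn. f_equal. lia.
  - intros i Hi. rewrite Nat.add_succ_r. apply Hm. lia.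
Qed.

Lemma partition_of_2 a b : a <= b ->
  is_partition a b 1 (fun i => match i with O => a | _ => b end).
Proof. intros H. repeat split. intros i Hi. replace i with O by lia. exact H. Qed.

Lemma partition_of_3 a b c : a <= b -> b <= c ->
  is_partition a c 2 (fun i => match i with O => a | S O => b | _ => c end).
Proof.
  intros Hab Hbc. repeat split. intros i Hi. destruct i as [|[|i]]; trivial. lia.
Qed.

Definition append_at (t : nat -> R) (n : nat) (u : R) (i : nat) : R :=
  if Nat.leb i n then t i else u.

Lemma append_at_le t n u i : (i <= n)%nat -> append_at t n u i = t i.
Proof. intros H. unfold append_at. rewrite (proj2 (Nat.leb_le i n)); trivial. Qed.

Lemma append_at_gt t n u i : (n < i)%nat -> append_at t n u i = u.
Proof. intros H. unfold append_at. rewrite (proj2 (Nat.leb_gt i n)); trivial. Qed.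

Lemma append_at_steps (P : R -> R -> Prop) t n u : P (t n) u ->
  (forall i, (i < n)%nat -> P (t i) (t (S i))) ->
  forall i, (i < S n)%nat -> P (append_at t n u i) (append_at t n u (S i)).
Proof.
  intros Hlast H i Hi. destruct (Nat.eq_dec i n) as [->|Hne].
  - rewrite append_at_le, append_at_gt by lia. exact Hlast.
  - rewrite !append_at_le by lia. apply H. lia.
Qed.

Lemma partition_append a v n t u : is_partition a v n t -> v <= u ->
  is_partition a u (S n) (append_at t n u).
Proof.
  intros (H0 & Hn & Hm) Hvu. split; [|split].
  - rewrite append_at_le by lia. exact H0.
  - rewrite append_at_gt by lia. reflexivity.
  - apply append_at_steps with (P := Rle); trivial. rewrite Hn. exact Hvu.
Qed.

Lemma partition_cons a u n t b : is_partition u b n t -> a <= u ->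
  is_partition a b (S n) (fun i => match i with O => a | S j => t j end).
Proof.
  intros (H0 & Hn & Hm) Hau. repeat split; trivial.
  intros [|i] Hi; [rewrite H0; exact Hau|apply Hm; lia].
Qed.

Lemma partition_Rmin a b c n t : a <= b <= c ->
  is_partition a c n t -> is_partition a b n (fun i => Rmin (t i) b).
Proof.
  intros Hb (H0 & Hn & H). repeat split.
  - rewrite H0. apply Rmin_left; lra.
  - rewrite Hn. apply Rmin_right; lra.
  - intros i Hi. apply Rle_min_compat_r. auto.
Qed.

Lemma partition_Rmax a b c n t : a <= b <= c ->
  is_partition a c n t -> is_partition b c n (fun i => Rmax (t i) b).
Proof.
  intros Hb (H0 & Hn & H). repeat split.
  - rewrite H0. apply Rmax_right; lra.
  - rewrite Hn. apply Rmax_left; lra.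
  - intros i Hi. apply Rle_max_compat_r. auto.
Qed.

Lemma partition_reflect a b n t k : is_partition a b n t ->
  is_partition (k - b) (k - a) n (fun i => k - t (n - i)%nat).
Proof.
  intros (H0 & Hn & H). repeat split.
  - rewrite Nat.sub_0_r, Hn. reflexivity.
  - rewrite Nat.sub_diag, H0. reflexivity.
  - intros i Hi. specialize (H (n - S i)%nat ltac:(lia)).
    replace (S (n - S i)) with (n - i)%nat in H by lia. lra.
Qed.

Definition partition_sum (c : R -> R -> R) (n : nat) (t : nat -> R) : R :=
  sumlt (fun i => c (t i) (t (S i))) n.

(* Both [curve_length] and [line_integral] are instances up to conversion. *)
Definition partition_sup (c : R -> R -> R) (a b : R) : Rbar :=
  Lub_Rbar (fun s => exists n t, is_partition a b n t /\ s = partition_sum c n t).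

Section PartitionSup.
Implicit Types c : R -> R -> R.

Lemma partition_sum_le_sup c a b n t : is_partition a b n t ->
  Rbar_le (partition_sum c n t) (partition_sup c a b).
Proof. intros H. apply Lub_Rbar_correct. eauto. Qed.

Lemma partition_sum_suffix c n t k : (k <= n)%nat ->
  partition_sum c (n - k) (fun i => t (k + i)%nat) = partition_sum c n t - partition_sum c k t.
Proof.
  intros Hk. unfold partition_sum.
  replace (sumlt _ n) with (sumlt (fun i => c (t i) (t (S i))) (k + (n - k))) by (f_equal; lia).
  rewrite sumlt_cat, (sumlt_ext (fun i => c (t (k + i)%nat) (t (k + S i)%nat))
    (fun i => c (t (k + i)%nat) (t (S (k + i))))).
  - ring.
  - intros i _. rewrite Nat.add_succ_r. reflexivity.
Qed.

Lemma partition_sup_le c a b (L : Rbar) :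
  (forall n t, is_partition a b n t -> Rbar_le (partition_sum c n t) L) ->
  Rbar_le (partition_sup c a b) L.
Proof. intros H. apply Lub_Rbar_correct. intros x (n & t & Ht & ->). auto. Qed.

Lemma partition_sup_ge c a b : a <= b -> Rbar_le (c a b) (partition_sup c a b).
Proof.
  intros H. pose proof (partition_sum_le_sup c _ _ _ _ (partition_of_2 a b H)) as Hs.
  unfold partition_sum in Hs. simpl in Hs. rewrite Rplus_0_l in Hs. exact Hs.
Qed.

Lemma partition_sup_ge_split c a m b : a <= m -> m <= b ->
  Rbar_le (c a m + c m b) (partition_sup c a b).
Proof.
  intros Ha Hb. pose proof (partition_sum_le_sup c _ _ _ _ (partition_of_3 a m b Ha Hb)) as Hs.
  unfold partition_sum in Hs. simpl in Hs. rewrite Rplus_0_l in Hs. exact Hs.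
Qed.

Lemma partition_sup_subinterval c a u v b :
  (forall s t, s <= t -> 0 <= c s t) -> a <= u -> v <= b ->
  Rbar_le (partition_sup c u v) (partition_sup c a b).
Proof.
  intros Hc Hau Hvb. apply partition_sup_le. intros n t Ht.
  eapply Rbar_le_trans; [|apply partition_sum_le_sup,
    (partition_cons a u _ _ b (partition_append u v n t b Ht Hvb) Hau)].
  unfold partition_sum. rewrite sumlt_first. simpl sumlt at 2.
  rewrite (sumlt_ext (fun i => c (append_at t n b i) (append_at t n b (S i)))
    (fun i => c (t i) (t (S i)))).
  - rewrite !append_at_le, append_at_gt by lia. destruct Ht as (H0 & Hn & _).
    rewrite H0, Hn. pose proof (Hc a u Hau). pose proof (Hc v b Hvb). simpl. lra.
  - intros i Hi. rewrite !append_at_le by lia. reflexivity.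
Qed.

Lemma partition_sup_monotone c c' a b :
  (forall u v, a <= u -> u <= v -> v <= b -> c u v <= c' u v) ->
  Rbar_le (partition_sup c a b) (partition_sup c' a b).
Proof.
  intros H. apply partition_sup_le. intros n t Ht.
  eapply Rbar_le_trans; [|apply partition_sum_le_sup, Ht].
  apply sumlt_le. intros i Hi. destruct (partition_step _ _ _ _ i Ht Hi) as (? & ? & ?). auto.
Qed.

Lemma partition_sup_ext c c' a b :
  (forall u v, a <= u -> u <= v -> v <= b -> c u v = c' u v) ->
  partition_sup c a b = partition_sup c' a b.
Proof.
  intros H. apply Rbar_le_antisym; apply partition_sup_monotone; intros; rewrite H; trivial; lra.
Qed.

Lemma partition_sup_reflect_le c a b k :
  Rbar_le (partition_sup (fun u v => c (k - v) (k - u)) a b)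
          (partition_sup c (k - b) (k - a)).
Proof.
  apply partition_sup_le. intros n t Ht.
  eapply Rbar_le_trans; [|apply partition_sum_le_sup, (partition_reflect a b n t k Ht)].
  unfold partition_sum. rewrite sumlt_rev. apply Req_le, sumlt_ext. intros i Hi.
  replace (S (n - S i)) with (n - i)%nat by lia. reflexivity.
Qed.

Lemma partition_sup_reflect c a b k :
  partition_sup (fun u v => c (k - v) (k - u)) a b = partition_sup c (k - b) (k - a).
Proof.
  apply Rbar_le_antisym; [apply partition_sup_reflect_le|].
  pose proof (partition_sup_reflect_le (fun u v => c (k - v) (k - u)) (k - b) (k - a) k) as H.
  replace (k - (k - a)) with a in H by ring. replace (k - (k - b)) with b in H by ring.
  rewrite <- (partition_sup_ext c) in H; [exact H|].
  intros u v _ _ _. f_equal; ring.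
Qed.

Lemma partition_sup_shift c a b h :
  partition_sup (fun u v => c (u + h) (v + h)) a b = partition_sup c (a + h) (b + h).
Proof.
  rewrite (partition_sup_ext _ (fun u v => c (h - (0 - u)) (h - (0 - v))))
    by (intros; f_equal; ring).
  rewrite (partition_sup_reflect (fun u v => c (h - v) (h - u)) a b 0), partition_sup_reflect.
  f_equal; ring.
Qed.

Lemma partition_sup_cat c a b e L1 L2 :
  0 <= c b b ->
  (forall u v, a <= u -> u <= b -> b <= v -> v <= e -> c u v <= c u b + c b v) ->
  a <= b <= e ->
  Rbar_le (partition_sup c a b) (Finite L1) -> Rbar_le (partition_sup c b e) (Finite L2) ->
  Rbar_le (partition_sup c a e) (Finite (L1 + L2)).
Proof.
  intros Hpos Hsplit Hb Hleft Hright. apply partition_sup_le. intros n t Ht.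
  pose proof (Rbar_le_trans _ _ _
    (partition_sum_le_sup c _ _ _ _ (partition_Rmin a b e n t Hb Ht)) Hleft) as Hmin.
  pose proof (Rbar_le_trans _ _ _
    (partition_sum_le_sup c _ _ _ _ (partition_Rmax a b e n t Hb Ht)) Hright) as Hmax.
  eapply Rle_trans; [|apply Rplus_le_compat; [exact Hmin|exact Hmax]].
  unfold partition_sum. rewrite <- sumlt_plus. apply sumlt_le. intros i Hi.
  destruct (partition_step _ _ _ _ i Ht Hi) as (Hu & Huv & Hv).
  destruct (Rle_dec (t (S i)) b); [|destruct (Rle_dec b (t i))].
  - rewrite !(Rmin_left _ b), !(Rmax_right _ b) by lra. lra.
  - rewrite !(Rmin_right _ b), !(Rmax_left _ b) by lra. lra.
  - rewrite (Rmin_left (t i)), (Rmin_right (t (S i))), (Rmax_right (t i)),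
      (Rmax_left (t (S i))) by lra.
    apply Hsplit; lra.
Qed.

Lemma partition_sup_le_increment c F a b :
  (forall u v, a <= u -> u <= v -> v <= b -> c u v <= F v - F u) ->
  Rbar_le (partition_sup c a b) (Finite (F b - F a)).
Proof.
  intros H. apply partition_sup_le. intros n t Ht.
  pose proof Ht as (H0 & Hn & _). rewrite <- H0, <- Hn, <- (sumlt_telescope (fun i => F (t i))).
  apply sumlt_le. intros i Hi. destruct (partition_step _ _ _ _ i Ht Hi) as (? & ? & ?). auto.
Qed.

End PartitionSup.

(** * Lengths and line integrals *)

Definition isometric_on {X : Type} (D : X -> X -> R) (g : R -> X) (u v : R) : Prop :=
  forall s t, u <= s <= v -> u <= t <= v -> D (g s) (g t) = Rabs (s - t).

Section Length.
Context {X : Type} {D : X -> X -> R} (HD : is_metric D).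
Implicit Types g : R -> X.

Lemma metric_nonneg x y : 0 <= D x y.
Proof. apply HD. Qed.

Lemma metric_refl x : D x x = 0.
Proof. apply HD. reflexivity. Qed.

Lemma metric_sym x y : D x y = D y x.
Proof. apply HD. Qed.

Lemma metric_tri x y z : D x z <= D x y + D y z.
Proof. apply HD. Qed.

Lemma chain_dist_le (a : nat -> X) r m i k :
  (forall j, (j < m)%nat -> D (a j) (a (S j)) <= r) -> (i + k <= m)%nat ->
  D (a i) (a (i + k)%nat) <= INR k * r.
Proof.
  intros Hstep. induction k as [|k IH]; intros Hk.
  - rewrite Nat.add_0_r, metric_refl. simpl. lra.
  - rewrite S_INR, Nat.add_succ_r. specialize (IH ltac:(lia)).
    specialize (Hstep (i + k)%nat ltac:(lia)).
    pose proof (metric_tri (a i) (a (i + k)%nat) (a (S (i + k)))). lra.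
Qed.

Lemma curve_length_ge_dist g a b : a <= b ->
  Rbar_le (D (g a) (g b)) (curve_length D g a b).
Proof. intros H. apply (partition_sup_ge (fun u v => D (g u) (g v))), H. Qed.

Lemma curve_length_ge_split g a m b : a <= m -> m <= b ->
  Rbar_le (D (g a) (g m) + D (g m) (g b)) (curve_length D g a b).
Proof. apply (partition_sup_ge_split (fun u v => D (g u) (g v))). Qed.

Lemma curve_length_nonneg g a b : a <= b -> Rbar_le 0 (curve_length D g a b).
Proof.
  intros H. eapply Rbar_le_trans; [|apply curve_length_ge_dist, H]. apply metric_nonneg.
Qed.

Lemma real_curve_length_nonneg g a b : a <= b -> 0 <= curve_length D g a b.
Proof.
  intros H. pose proof (curve_length_nonneg g a b H).
  destruct (curve_length D g a b); simpl in *; lra.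
Qed.

Lemma curve_length_subcurve g a u v b : a <= u -> v <= b ->
  Rbar_le (curve_length D g u v) (curve_length D g a b).
Proof.
  apply (partition_sup_subinterval (fun u v => D (g u) (g v))). intros; apply metric_nonneg.
Qed.

Lemma rectifiable_subcurve g a u v b : a <= u -> u <= v -> v <= b ->
  rectifiable D g a b -> rectifiable D g u v.
Proof.
  intros Hau Huv Hvb Hr. apply (Rbar_between_finite _ 0 (curve_length D g a b)).
  - apply curve_length_nonneg, Huv.
  - rewrite Hr. apply curve_length_subcurve; assumption.
Qed.

Lemma curve_length_ext g g' a b : (forall s, a <= s <= b -> g s = g' s) ->
  curve_length D g a b = curve_length D g' a b.
Proof.
  intros H. apply (partition_sup_ext (fun u v => D (g u) (g v)) (fun u v => D (g' u) (g' v))).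
  intros u v Hu Huv Hv. rewrite !H; trivial; lra.
Qed.

Lemma curve_length_shift g a b h :
  curve_length D (fun s => g (s + h)) a b = curve_length D g (a + h) (b + h).
Proof. apply (partition_sup_shift (fun u v => D (g u) (g v))). Qed.

Lemma curve_length_reflect g a b k :
  curve_length D (fun s => g (k - s)) a b = curve_length D g (k - b) (k - a).
Proof.
  transitivity (partition_sup (fun u v => D (g (k - v)) (g (k - u))) a b).
  - apply (partition_sup_ext (fun u v => D (g (k - u)) (g (k - v)))). intros; apply metric_sym.
  - apply (partition_sup_reflect (fun u v => D (g u) (g v))).
Qed.

Lemma curve_length_cat g a b c L1 L2 : a <= b <= c ->
  Rbar_le (curve_length D g a b) (Finite L1) ->
  Rbar_le (curve_length D g b c) (Finite L2) ->
  Rbar_le (curve_length D g a c) (Finite (L1 + L2)).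
Proof.
  apply (partition_sup_cat (fun u v => D (g u) (g v))).
  - apply metric_nonneg.
  - intros; apply metric_tri.
Qed.

Lemma rectifiable_cat g a b c : a <= b <= c ->
  rectifiable D g a b -> rectifiable D g b c ->
  rectifiable D g a c /\ curve_length D g a c <= curve_length D g a b + curve_length D g b c.
Proof.
  intros Hb Rab Rbc.
  assert (Hlow : Rbar_le 0 (curve_length D g a c)) by (apply curve_length_nonneg; lra).
  assert (Hup : Rbar_le (curve_length D g a c)
    (curve_length D g a b + curve_length D g b c)).
  { apply (curve_length_cat g a b c); trivial; rewrite ?Rab, ?Rbc; apply Rbar_le_refl. }
  split; [apply (Rbar_between_finite _ _ _ Hlow Hup)|apply (real_Rbar_bounds _ _ _ Hlow Hup)].
Qed.

Lemma isometric_on_sub g u v u' v' : u <= u' -> v' <= v ->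
  isometric_on D g u v -> isometric_on D g u' v'.
Proof. intros Hu Hv H s t Hs Ht. apply H; lra. Qed.

Lemma isometric_on_dist g u v s t : isometric_on D g u v -> u <= s -> s <= t -> t <= v ->
  D (g s) (g t) = t - s.
Proof. intros H Hs Hst Ht. rewrite H by lra. rewrite Rabs_left1; lra. Qed.

Lemma isometric_on_is_curve g u v : u <= v -> isometric_on D g u v -> is_curve D g u v.
Proof.
  intros Huv H. split; trivial. intros t Ht e He. exists e. split; trivial.
  intros s Hs Hst. rewrite H; trivial.
Qed.

Lemma isometric_on_curve_length g u v : u <= v -> isometric_on D g u v ->
  curve_length D g u v = v - u.
Proof.
  intros Huv H. apply Rbar_le_antisym.
  - apply (partition_sup_le_increment (fun s t => D (g s) (g t)) (fun t => t)).
    intros s t Hs Hst Ht. rewrite (isometric_on_dist g u v); trivial. lra.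
  - eapply Rbar_le_trans; [|apply curve_length_ge_dist, Huv].
    rewrite (isometric_on_dist g u v) by (trivial; lra). apply Rbar_le_refl.
Qed.

End Length.

Section LineIntegral.
Context {X : Type} {D : X -> X -> R} (HD : is_metric D).
Context {rho : X -> R} (rho_nonneg : forall x, 0 <= rho x).
Implicit Types g : R -> X.

Lemma inf_on_ge g u v m : u <= v ->
  (forall s, u <= s <= v -> m <= rho (g s)) -> m <= inf_on rho g u v.
Proof.
  intros Huv H. apply (real_Glb_Rbar_bounds _ m (rho (g u))).
  - intros y (s & Hs & ->). auto.
  - exists u. split; [lra|reflexivity].
Qed.

Lemma inf_on_le g u v s : u <= s <= v -> inf_on rho g u v <= rho (g s).
Proof.
  intros Hs. apply (real_Glb_Rbar_bounds _ 0).
  - intros y (s' & Hs' & ->). auto.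
  - exists s. split; auto.
Qed.

Lemma inf_on_nonneg g u v : u <= v -> 0 <= inf_on rho g u v.
Proof. intros H. apply inf_on_ge; auto. Qed.

Lemma inf_on_antitone g u v u' v' : u <= u' -> u' <= v' -> v' <= v ->
  inf_on rho g u v <= inf_on rho g u' v'.
Proof. intros. apply inf_on_ge; [lra|]. intros s Hs. apply inf_on_le. lra. Qed.

Lemma inf_on_ext g g' u v : (forall s, u <= s <= v -> g s = g' s) ->
  inf_on rho g u v = inf_on rho g' u v.
Proof.
  intros H. unfold inf_on. f_equal. apply Glb_Rbar_eqset.
  intros x; split; intros (s & Hs & ->); exists s; rewrite H; auto.
Qed.

Lemma inf_on_reflect g k u v :
  inf_on rho (fun s => g (k - s)) u v = inf_on rho g (k - v) (k - u).
Proof.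
  unfold inf_on. f_equal. apply Glb_Rbar_eqset.
  intros x; split; intros (s & Hs & ->); exists (k - s); (split; [lra|]); do 2 f_equal; ring.
Qed.

Lemma inf_on_shift g h u v :
  inf_on rho (fun s => g (s + h)) u v = inf_on rho g (u + h) (v + h).
Proof.
  rewrite (inf_on_ext _ (fun s => g (h - (0 - s)))) by (intros; f_equal; ring).
  rewrite (inf_on_reflect (fun s => g (h - s)) 0), inf_on_reflect. f_equal; ring.
Qed.

Definition darboux_term (g : R -> X) (u v : R) : R :=
  inf_on rho g u v * curve_length D g u v.

Lemma darboux_term_nonneg g u v : u <= v -> 0 <= darboux_term g u v.
Proof.
  intros H. apply Rmult_le_pos; [apply inf_on_nonneg, H|].
  apply (real_curve_length_nonneg HD), H.
Qed.

Lemma darboux_term_split g u b v : u <= b -> b <= v -> rectifiable D g u v ->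
  darboux_term g u v <= darboux_term g u b + darboux_term g b v.
Proof.
  intros Hu Hv Hr. unfold darboux_term.
  assert (Rub : rectifiable D g u b) by (apply (rectifiable_subcurve HD g u u b v); trivial; lra).
  assert (Rbv : rectifiable D g b v) by (apply (rectifiable_subcurve HD g u b v v); trivial; lra).
  destruct (rectifiable_cat HD g u b v (conj Hu Hv) Rub Rbv) as [_ Hlen].
  pose proof (inf_on_nonneg g u v ltac:(lra)).
  pose proof (inf_on_antitone g u v u b ltac:(lra) Hu Hv).
  pose proof (inf_on_antitone g u v b v Hu Hv ltac:(lra)).
  pose proof (real_curve_length_nonneg HD g u b Hu).
  pose proof (real_curve_length_nonneg HD g b v Hv).
  nra.
Qed.

Lemma line_integral_ge_split g a m b : a <= m -> m <= b ->
  Rbar_le (darboux_term g a m + darboux_term g m b) (line_integral D rho g a b).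
Proof. apply (partition_sup_ge_split (darboux_term g)). Qed.

Lemma line_integral_nonneg g a b : a <= b -> Rbar_le 0 (line_integral D rho g a b).
Proof.
  intros H. eapply Rbar_le_trans; [|apply (partition_sup_ge (darboux_term g)), H].
  apply darboux_term_nonneg, H.
Qed.

Lemma line_integral_ext g g' a b : (forall s, a <= s <= b -> g s = g' s) ->
  line_integral D rho g a b = line_integral D rho g' a b.
Proof.
  intros H. apply (partition_sup_ext (darboux_term g) (darboux_term g')).
  intros u v Hu Huv Hv.
  assert (Huv_ext : forall s, u <= s <= v -> g s = g' s) by (intros; apply H; lra).
  unfold darboux_term. f_equal; [apply inf_on_ext|f_equal; apply curve_length_ext]; trivial.
Qed.

Lemma line_integral_shift g a b h :
  line_integral D rho (fun s => g (s + h)) a b = line_integral D rho g (a + h) (b + h).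
Proof.
  transitivity (partition_sup (fun u v => darboux_term g (u + h) (v + h)) a b).
  - apply (partition_sup_ext (darboux_term (fun s => g (s + h)))). intros u v _ _ _.
    unfold darboux_term. rewrite inf_on_shift, curve_length_shift. reflexivity.
  - apply (partition_sup_shift (darboux_term g)).
Qed.

Lemma line_integral_reflect g a b k :
  line_integral D rho (fun s => g (k - s)) a b = line_integral D rho g (k - b) (k - a).
Proof.
  transitivity (partition_sup (fun u v => darboux_term g (k - v) (k - u)) a b).
  - apply (partition_sup_ext (darboux_term (fun s => g (k - s)))). intros u v _ _ _.
    unfold darboux_term. rewrite inf_on_reflect, (curve_length_reflect HD). reflexivity.
  - apply (partition_sup_reflect (darboux_term g)).
Qed.

Lemma line_integral_cat g a b c I1 I2 : a <= b <= c -> rectifiable D g a c ->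
  Rbar_le (line_integral D rho g a b) (Finite I1) ->
  Rbar_le (line_integral D rho g b c) (Finite I2) ->
  Rbar_le (line_integral D rho g a c) (Finite (I1 + I2)).
Proof.
  intros Hb Hr. apply (partition_sup_cat (darboux_term g)); trivial.
  - apply darboux_term_nonneg, Rle_refl.
  - intros u v Hu Hub Hbv Hv. apply darboux_term_split; trivial.
    apply (rectifiable_subcurve HD g a u v c); trivial; lra.
Qed.

(* [F] is a primitive of a majorant [f] of the density along [g]; the value of
   [f] at the mean value point bounds the infimum over the interval. *)
Lemma isometric_on_line_integral_le g u v (f F : R -> R) : u <= v -> isometric_on D g u v ->
  (forall s, u <= s <= v -> is_derive F s (f s)) ->
  (forall s, u <= s <= v -> rho (g s) <= f s) ->
  Rbar_le (line_integral D rho g u v) (Finite (F v - F u)).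
Proof.
  intros Huv Hg HF Hf. apply (partition_sup_le_increment (darboux_term g)).
  intros s t Hs Hst Ht. unfold darboux_term.
  rewrite (isometric_on_curve_length g s t Hst) by (apply (isometric_on_sub g u v); trivial).
  destruct (MVT_gen F s t f) as (c & Hc & ->).
  - intros x. rewrite Rmin_left, Rmax_right by lra. intros Hx. apply HF. lra.
  - intros x. rewrite Rmin_left, Rmax_right by lra. intros Hx.
    apply continuity_pt_filterlim, (ex_derive_continuous F). exists (f x). apply HF. lra.
  - rewrite Rmin_left, Rmax_right in Hc by lra. simpl. apply Rmult_le_compat_r; [lra|].
    eapply Rle_trans; [apply inf_on_le, Hc|apply Hf; lra].
Qed.

End LineIntegral.

Arguments darboux_term {X} D rho g u v.

(** * Curves *)

Lemma is_lub_approx (E : R -> Prop) T e : is_lub E T -> 0 < e -> exists s, E s /\ T - e < s <= T.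
Proof.
  intros [Hub Hleast] He. apply NNPP. intros Hno.
  apply (Rlt_not_le T (T - e)); [lra|]. apply Hleast. intros s Hs.
  apply Rnot_lt_le. intros Hlt. apply Hno. exists s. split; [|split]; trivial. apply Hub, Hs.
Qed.

Lemma interval_induction (P : R -> Prop) a b : a <= b -> P a ->
  (forall t, a <= t <= b -> exists eta, 0 < eta /\ forall s u,
     a <= s -> s <= u -> u <= b -> t - eta < s -> u < t + eta -> P s -> P u) ->
  P b.
Proof.
  intros Hab Pa Hloc. set (E := fun u => a <= u <= b /\ P u).
  assert (Ea : E a) by (split; [lra|exact Pa]).
  destruct (completeness E) as [T HT]; [exists b; intros u [Hu _]; lra|eauto|].
  pose proof (proj1 HT a Ea) as HaT.
  assert (HTb : T <= b) by (apply HT; intros u [Hu _]; lra).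
  destruct (Hloc T) as (eta & Heta & Hext); [lra|].
  destruct (is_lub_approx E T eta HT Heta) as (s & [Hs Ps] & HsT).
  set (u := Rmin b (T + eta / 2)).
  assert (Hub : u <= b) by apply Rmin_l. assert (HuT : u <= T + eta / 2) by apply Rmin_r.
  assert (Hsu : s <= u) by (apply Rmin_glb; lra).
  assert (Pu : P u) by (apply (Hext s); trivial; lra).
  assert (HuT' : u <= T) by (apply HT; split; trivial; lra).
  replace b with u; trivial. unfold u in HuT' |- *.
  destruct (Rle_dec b (T + eta / 2)); [apply Rmin_left; trivial|].
  rewrite Rmin_right in HuT'; lra.
Qed.

Lemma first_passage f a b r : is_curve Rdist f a b -> f a <= r <= f b ->
  exists T, a <= T <= b /\ f T = r /\ forall s, a <= s <= T -> f s <= r.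
Proof.
  intros [Hab Hcont] Hr.
  set (E := fun t => a <= t <= b /\ forall s, a <= s <= t -> f s <= r).
  assert (Ea : E a) by (split; [lra|]; intros s Hs; replace s with a by lra; lra).
  destruct (completeness E) as [T HT]; [exists b; intros u [Hu _]; lra|eauto|].
  pose proof (proj1 HT a Ea) as HaT.
  assert (HTb : T <= b) by (apply HT; intros u [Hu _]; lra).
  assert (Hbelow : forall s, a <= s < T -> f s <= r).
  { intros s Hs. destruct (is_lub_approx E T (T - s) HT) as (u & [_ Hu] & HuT); [lra|].
    apply Hu. lra. }
  unfold Rdist in Hcont. exists T. split; [lra|].
  destruct (Rtotal_order (f T) r) as [Hlt|[Heq|Hgt]].
  - exfalso. destruct (Hcont T ltac:(lra) (r - f T) ltac:(lra)) as (eta & Heta & Hnear).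
    assert (HTb' : T <> b) by (intros ->; lra).
    set (u := Rmin b (T + eta / 2)). assert (HTu : T < u) by (apply Rmin_glb_lt; lra).
    assert (Hub : u <= b) by apply Rmin_l. assert (HuT : u <= T + eta / 2) by apply Rmin_r.
    apply (Rlt_not_le u T HTu), HT. split; [lra|]. intros s Hs.
    destruct (Rlt_dec s T); [apply Hbelow; lra|].
    pose proof (Hnear s ltac:(lra) ltac:(apply Rabs_def1; lra)) as H. apply Rabs_def2 in H. lra.
  - split; trivial. intros s Hs. destruct (Req_dec s T) as [->|]; [lra|apply Hbelow; lra].
  - exfalso. destruct (Hcont T ltac:(lra) (f T - r) ltac:(lra)) as (eta & Heta & Hnear).
    assert (HaT' : T <> a) by (intros ->; lra).
    set (s := Rmax a (T - eta / 2)). assert (HsT : s < T) by (apply Rmax_lub_lt; lra).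
    assert (Has : a <= s) by apply Rmax_l. assert (HTs : T - eta / 2 <= s) by apply Rmax_r.
    pose proof (Hbelow s (conj Has HsT)).
    pose proof (Hnear s ltac:(lra) ltac:(apply Rabs_def1; lra)) as Hs. apply Rabs_def2 in Hs. lra.
Qed.

Definition curve_cat {X : Type} (g1 g2 : R -> X) (b t : R) : X :=
  if Rle_dec t b then g1 t else g2 t.

Lemma curve_cat_left {X : Type} (g1 g2 : R -> X) b t : t <= b -> curve_cat g1 g2 b t = g1 t.
Proof. intros H. unfold curve_cat. destruct (Rle_dec t b); [easy|lra]. Qed.

Lemma curve_cat_right {X : Type} (g1 g2 : R -> X) b t :
  g1 b = g2 b -> b <= t -> curve_cat g1 g2 b t = g2 t.
Proof.
  intros Hg H. unfold curve_cat. destruct (Rle_dec t b); [|easy].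
  replace t with b by lra. exact Hg.
Qed.

Section Curves.
Context {X : Type} {D : X -> X -> R} (HD : is_metric D).
Implicit Types g : R -> X.

Lemma is_curve_dist_to g a b x :
  is_curve D g a b -> is_curve Rdist (fun t => D x (g t)) a b.
Proof.
  intros [Hab Hcont]. split; trivial. intros t Ht e He.
  destruct (Hcont t Ht e He) as (eta & Heta & Hnear). exists eta. split; trivial.
  intros s Hs Hst. specialize (Hnear s Hs Hst).
  pose proof (metric_tri HD x (g s) (g t)). pose proof (metric_tri HD x (g t) (g s)).
  rewrite (metric_sym HD (g t)) in *. apply Rabs_def1; lra.
Qed.

Lemma is_curve_ext g g' a b : (forall s, a <= s <= b -> g s = g' s) ->
  is_curve D g a b -> is_curve D g' a b.
Proof.
  intros Hg [Hab Hcont]. split; trivial. intros t Ht e He.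
  destruct (Hcont t Ht e He) as (eta & Heta & Hnear). exists eta. split; trivial.
  intros s Hs Hst. rewrite <- !Hg by trivial. auto.
Qed.

Lemma is_curve_shift g a b h :
  is_curve D g (a + h) (b + h) -> is_curve D (fun s => g (s + h)) a b.
Proof.
  intros [Hab Hcont]. split; [lra|]. intros t Ht e He.
  destruct (Hcont (t + h) ltac:(lra) e He) as (eta & Heta & Hnear). exists eta. split; trivial.
  intros s Hs Hst. apply Hnear; [lra|]. replace (s + h - (t + h)) with (s - t) by ring. exact Hst.
Qed.

Lemma is_curve_reflect g a b k :
  is_curve D g (k - b) (k - a) -> is_curve D (fun s => g (k - s)) a b.
Proof.
  intros [Hab Hcont]. split; [lra|]. intros t Ht e He.
  destruct (Hcont (k - t) ltac:(lra) e He) as (eta & Heta & Hnear). exists eta. split; trivial.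
  intros s Hs Hst. apply Hnear; [lra|].
  replace (k - s - (k - t)) with (- (s - t)) by ring. rewrite Rabs_Ropp. exact Hst.
Qed.

Lemma is_curve_join g a b c :
  is_curve D g a b -> is_curve D g b c -> is_curve D g a c.
Proof.
  intros [Hab Cab] [Hbc Cbc]. split; [lra|]. intros t Ht e He.
  assert (Hleft : exists eta, 0 < eta /\
    forall s, a <= s <= b -> Rabs (s - t) < eta -> D (g s) (g t) < e).
  { destruct (Rle_dec t b); [apply Cab; trivial; lra|].
    exists (t - b). split; [lra|]. intros s Hs Hst. apply Rabs_def2 in Hst. lra. }
  assert (Hright : exists eta, 0 < eta /\
    forall s, b <= s <= c -> Rabs (s - t) < eta -> D (g s) (g t) < e).
  { destruct (Rle_dec b t); [apply Cbc; trivial; lra|].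
    exists (b - t). split; [lra|]. intros s Hs Hst. apply Rabs_def2 in Hst. lra. }
  destruct Hleft as (eta & Heta & Hleft), Hright as (eta' & Heta' & Hright).
  exists (Rmin eta eta'). split; [apply Rmin_glb_lt; trivial|].
  intros s Hs Hst. pose proof (Rmin_l eta eta'). pose proof (Rmin_r eta eta').
  destruct (Rle_dec s b); [apply Hleft|apply Hright]; lra.
Qed.

Definition steps_within g lo hi n (t : nat -> R) : Prop :=
  forall i, (i < n)%nat -> lo <= D (g (t i)) (g (t (S i))) <= hi.

Lemma steps_within_append g lo hi n t u : steps_within g lo hi n t ->
  lo <= D (g (t n)) (g u) <= hi -> steps_within g lo hi (S n) (append_at t n u).
Proof.
  intros Hsteps Hlast.
  exact (append_at_steps (fun x y => lo <= D (g x) (g y) <= hi) t n u Hlast Hsteps).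
Qed.

Lemma curve_chain_with_remainder g a b r : is_curve D g a b -> 0 < r ->
  exists v n t, is_partition a v n t /\ v <= b /\
    steps_within g (2 * r) (4 * r) n t /\ D (g v) (g b) <= 4 * r.
Proof.
  intros [Hab Hcont] Hr.
  set (P := fun u => exists v n t, is_partition a v n t /\ v <= u /\
    steps_within g (2 * r) (4 * r) n t /\ D (g v) (g u) <= 4 * r).
  apply (interval_induction P a b Hab).
  - exists a, O, (fun _ => a). rewrite (metric_refl HD).
    repeat split; try lra; intros; lia.
  - intros w Hw. destruct (Hcont w Hw r Hr) as (eta & Heta & Hnear). exists eta. split; trivial.
    intros s u Has Hsu Hub Hs Hu (v & n & t & Ht & Hvs & Hsteps & Hv).
    assert (Dsu : D (g s) (g u) <= 2 * r).
    { pose proof (Hnear s ltac:(lra) ltac:(apply Rabs_def1; lra)).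
      pose proof (Hnear u ltac:(lra) ltac:(apply Rabs_def1; lra)).
      pose proof (metric_tri HD (g s) (g w) (g u)). rewrite (metric_sym HD (g w)) in *. lra. }
    destruct (Rle_dec (D (g v) (g s)) (2 * r)).
    + exists v, n, t. pose proof (metric_tri HD (g v) (g s) (g u)).
      split; [|split; [|split]]; trivial; lra.
    + exists s, (S n), (append_at t n s). split; [|split; [|split]]; try lra.
      * apply (partition_append a v); trivial.
      * apply steps_within_append; trivial. destruct Ht as (_ & -> & _). lra.
Qed.

(* A final piece shorter than [r] is merged into the step before it. *)
Lemma curve_chain g a b r : is_curve D g a b -> 0 < r -> r <= D (g a) (g b) ->
  exists n t, is_partition a b n t /\ steps_within g r (5 * r) n t.
Proof.
  intros Hg Hr Hdist.
  destruct (curve_chain_with_remainder g a b r Hg Hr) as (v & n & t & Ht & Hvb & Hsteps & Hv).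
  assert (Hfinish : forall k, (k <= n)%nat -> r <= D (g (t k)) (g b) <= 5 * r ->
    exists n t, is_partition a b n t /\ steps_within g r (5 * r) n t).
  { intros k Hk Hlast. exists (S k), (append_at t k b). split.
    - apply (partition_append a (t k)); [apply (partition_prefix a v n); trivial|].
      pose proof (partition_le _ _ _ _ k n Ht ltac:(lia)).
      destruct Ht as (_ & Hn & _). lra.
    - apply steps_within_append; trivial. intros i Hi. specialize (Hsteps i ltac:(lia)). lra. }
  destruct Ht as (H0 & Hn & _). destruct (Rle_dec r (D (g v) (g b))).
  - apply (Hfinish n (le_n n)). rewrite Hn. lra.
  - destruct n as [|n]; [rewrite <- Hn, H0 in *; lra|].
    apply (Hfinish n); [lia|]. specialize (Hsteps n ltac:(lia)). rewrite Hn in Hsteps.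
    pose proof (metric_tri HD (g (t n)) (g v) (g b)).
    pose proof (metric_tri HD (g (t n)) (g b) (g v)). rewrite (metric_sym HD (g b)) in *. lra.
Qed.

End Curves.

Arguments steps_within {X} D g lo hi n t.

(** * The distance of a density *)

Definition joins {X : Type} (d : X -> X -> R) (rho : X -> R) (a b : R) (g : R -> X)
  (x y : X) (I : R) : Prop :=
  is_curve d g a b /\ rectifiable d g a b /\ g a = x /\ g b = y /\
  line_integral d rho g a b = Finite I.

Definition density_dist {X : Type} (d : X -> X -> R) (rho : X -> R) (x y : X) : R :=
  Glb_Rbar (fun I => exists a b g, joins d rho a b g x y I).

Section DensityDistance.
Context {X : Type} {d : X -> X -> R} (Hd : is_metric d).
Context {rho : X -> R} (rho_nonneg : forall x, 0 <= rho x).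

Notation joined x y I := (exists a b g, joins d rho a b g x y I).

Lemma joins_of_line_integral_le a b g (L : R) : is_curve d g a b -> rectifiable d g a b ->
  Rbar_le (line_integral d rho g a b) L ->
  exists I, joins d rho a b g (g a) (g b) I /\ I <= L.
Proof.
  intros Hg Hr HL. pose proof (line_integral_nonneg Hd rho_nonneg g a b (proj1 Hg)) as H0.
  exists (line_integral d rho g a b). split; [|apply (real_Rbar_bounds _ _ _ H0 HL)].
  repeat split; trivial; try apply Hg. symmetry. apply (Rbar_between_finite _ _ _ H0 HL).
Qed.

Lemma joins_nonneg a b g x y I : joins d rho a b g x y I -> 0 <= I.
Proof.
  intros ([Hab _] & _ & _ & _ & HI).
  pose proof (line_integral_nonneg Hd rho_nonneg g a b Hab) as H. rewrite HI in H. exact H.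
Qed.

Lemma joins_ext a b g g' x y I : a <= b -> (forall s, a <= s <= b -> g s = g' s) ->
  joins d rho a b g x y I -> joins d rho a b g' x y I.
Proof.
  intros Hab Hg (Hc & Hr & <- & <- & HI). split; [|split; [|split; [|split]]].
  - apply (is_curve_ext g); trivial.
  - unfold rectifiable. rewrite <- (curve_length_ext g); trivial.
  - symmetry. apply Hg. lra.
  - symmetry. apply Hg. lra.
  - rewrite <- HI. symmetry. apply line_integral_ext. exact Hg.
Qed.

Lemma joins_shift a b g x y I h : joins d rho (a + h) (b + h) g x y I ->
  joins d rho a b (fun s => g (s + h)) x y I.
Proof.
  intros (Hc & Hr & Hx & Hy & HI). split; [|split; [|split; [|split]]]; trivial.
  - apply is_curve_shift, Hc.
  - unfold rectifiable. rewrite curve_length_shift. exact Hr.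
  - rewrite line_integral_shift. exact HI.
Qed.

Lemma joins_reflect a b g x y I :
  joins d rho a b g x y I -> joins d rho a b (fun s => g (a + b - s)) y x I.
Proof.
  intros (Hc & Hr & Hx & Hy & HI).
  assert (Ea : a + b - b = a) by ring. assert (Eb : a + b - a = b) by ring.
  split; [|split; [|split; [|split]]]; rewrite ?Ea, ?Eb; trivial.
  - apply is_curve_reflect. rewrite Ea, Eb. exact Hc.
  - unfold rectifiable. rewrite (curve_length_reflect Hd), Ea, Eb. exact Hr.
  - rewrite (line_integral_reflect Hd), Ea, Eb. exact HI.
Qed.

Lemma joins_cat a b c g x y z I J : joins d rho a b g x y I -> joins d rho b c g y z J ->
  exists K, joins d rho a c g x z K /\ K <= I + J.
Proof.
  intros (Cab & Rab & <- & _ & HI) (Cbc & Rbc & _ & <- & HJ).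
  assert (Hb : a <= b <= c) by (split; [apply Cab|apply Cbc]).
  destruct (rectifiable_cat Hd g a b c Hb Rab Rbc) as [Hr _].
  apply joins_of_line_integral_le; trivial; [apply (is_curve_join g a b c Cab Cbc)|].
  apply (line_integral_cat Hd rho_nonneg g a b c); trivial;
    rewrite ?HI, ?HJ; apply Rbar_le_refl.
Qed.

Lemma joined_trans x y z I J : joined x y I -> joined y z J ->
  exists K, joined x z K /\ K <= I + J.
Proof.
  intros (a & b & g & Hg) (a' & c & g' & Hg').
  set (h := a' - b). set (k := fun s => g' (s + h)).
  assert (Hk : joins d rho b (c - h) k y z J).
  { apply joins_shift. replace (b + h) with a' by (unfold h; ring).
    replace (c - h + h) with c by ring. exact Hg'. }
  assert (Hb : g b = k b) by (transitivity y; [apply Hg|symmetry; apply Hk]).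
  destruct (joins_cat a b (c - h) (curve_cat g k b) x y z I J) as (K & HK & Hle).
  - apply (joins_ext a b g); trivial; [apply Hg|].
    intros s Hs. symmetry. apply curve_cat_left. lra.
  - apply (joins_ext b (c - h) k); trivial; [apply Hk|].
    intros s Hs. symmetry. apply curve_cat_right; trivial. lra.
  - eauto 6.
Qed.

Lemma density_dist_le a b g x y I : joins d rho a b g x y I -> density_dist d rho x y <= I.
Proof.
  intros H. apply (real_Glb_Rbar_bounds _ 0); [|eauto].
  intros J (a' & b' & g' & HJ). apply (joins_nonneg _ _ _ _ _ _ HJ).
Qed.

Lemma isometric_on_joins g u v (f F : R -> R) : u <= v -> isometric_on d g u v ->
  (forall s, u <= s <= v -> is_derive F s (f s)) ->
  (forall s, u <= s <= v -> rho (g s) <= f s) ->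
  exists I, joins d rho u v g (g u) (g v) I /\ I <= F v - F u.
Proof.
  intros Huv Hg HF Hf. apply joins_of_line_integral_le.
  - apply isometric_on_is_curve; trivial.
  - unfold rectifiable. rewrite (isometric_on_curve_length g u v Huv Hg). reflexivity.
  - apply (isometric_on_line_integral_le rho_nonneg g u v f F); trivial.
Qed.

Lemma isometric_on_density_length_le g u v (f F : R -> R) : isometric_on d g u v ->
  (forall s, u <= s <= v -> is_derive F s (f s)) ->
  (forall s, u <= s <= v -> rho (g s) <= f s) ->
  Rbar_le (curve_length (density_dist d rho) g u v) (Finite (F v - F u)).
Proof.
  intros Hg HF Hf.
  apply (partition_sup_le_increment (fun s t => density_dist d rho (g s) (g t))).
  intros s t Hs Hst Ht.
  destruct (isometric_on_joins g s t f F) as (I & HI & Hle); trivial.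
  - apply (isometric_on_sub g u v); trivial.
  - intros; apply HF; lra.
  - intros; apply Hf; lra.
  - pose proof (density_dist_le _ _ _ _ _ _ HI). lra.
Qed.

Hypothesis Hgeod : geodesic_space d.
Context {B : R} (rho_le : forall x, rho x <= B).

Lemma joined_by_geodesic x y : exists I, joined x y I /\ I <= B * d x y.
Proof.
  destruct (Hgeod x y) as (g & G0 & G1 & Hg).
  destruct (isometric_on_joins g 0 (d x y) (fun _ => B) (fun s => B * s))
    as (I & HI & Hle); trivial.
  - apply (metric_nonneg Hd).
  - intros s _. auto_derive; trivial. ring.
  - rewrite G0, G1 in HI. exists I. split; [eauto|lra].
Qed.

Lemma density_dist_le_dist x y : density_dist d rho x y <= B * d x y.
Proof.
  destruct (joined_by_geodesic x y) as (I & (a & b & g & HI) & Hle).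
  pose proof (density_dist_le _ _ _ _ _ _ HI). lra.
Qed.

Lemma density_dist_greatest x y m :
  (forall a b g I, joins d rho a b g x y I -> m <= I) -> m <= density_dist d rho x y.
Proof.
  intros H. destruct (joined_by_geodesic x y) as (I & HI & _).
  apply (real_Glb_Rbar_bounds _ m I); trivial. intros J (a & b & g & HJ). eauto.
Qed.

Lemma density_dist_nonneg x y : 0 <= density_dist d rho x y.
Proof. apply density_dist_greatest. intros a b g I. apply joins_nonneg. Qed.

Lemma density_dist_sym x y : density_dist d rho x y = density_dist d rho y x.
Proof.
  apply Rle_antisym; apply density_dist_greatest; intros a b g I HI;
    apply joins_reflect in HI; apply (density_dist_le _ _ _ _ _ _ HI).
Qed.

Lemma density_dist_tri x y z :
  density_dist d rho x z <= density_dist d rho x y + density_dist d rho y z.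
Proof.
  assert (H : density_dist d rho x z - density_dist d rho y z <= density_dist d rho x y);
    [|lra].
  apply density_dist_greatest. intros a b g I HI.
  assert (H : density_dist d rho x z - I <= density_dist d rho y z); [|lra].
  apply density_dist_greatest. intros a' b' g' J HJ.
  destruct (joined_trans x y z I J) as (K & (a'' & b'' & g'' & HK) & Hle); [eauto|eauto|].
  pose proof (density_dist_le _ _ _ _ _ _ HK). lra.
Qed.

Lemma density_dist_refl x : density_dist d rho x x = 0.
Proof.
  pose proof (density_dist_le_dist x x) as H. rewrite (metric_refl Hd) in H.
  pose proof (density_dist_nonneg x x). lra.
Qed.

(* A curve leaving the ball of radius [r] has a piece of length at least [r] inside it. *)
Lemma density_dist_ge x y r m : 0 <= m -> 0 <= r <= d x y ->
  (forall z, d x z <= r -> m <= rho z) -> m * r <= density_dist d rho x y.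
Proof.
  intros Hm Hr Hrho. apply density_dist_greatest. intros a b g I (Hg & Hrect & Hx & Hy & HI).
  destruct (first_passage (fun t => d x (g t)) a b r) as (T & HT & HdT & Hin).
  { apply (is_curve_dist_to Hd), Hg. }
  { rewrite Hx, Hy, (metric_refl Hd). exact Hr. }
  pose proof (line_integral_ge_split (D := d) (rho := rho) g a T b ltac:(lra) ltac:(lra)) as H.
  rewrite HI in H. simpl in H.
  pose proof (darboux_term_nonneg Hd rho_nonneg g T b ltac:(lra)) as Hrest.
  assert (Hinf : m <= inf_on rho g a T).
  { apply inf_on_ge; [lra|]. intros s Hs. apply Hrho, Hin, Hs. }
  assert (Hlen : r <= curve_length d g a T).
  { assert (HrT : rectifiable d g a T)
      by (apply (rectifiable_subcurve Hd g a a T b); trivial; lra).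
    pose proof (curve_length_ge_dist (D := d) g a T ltac:(lra)) as Hl.
    rewrite <- HrT, Hx, HdT in Hl. exact Hl. }
  assert (m * r <= darboux_term d rho g a T) by (apply Rmult_le_compat; trivial; lra).
  lra.
Qed.

End DensityDistance.

(** * Sequences and the metric boundary *)

Lemma is_lim_seq_0_nonneg (u : nat -> R) : (forall n, 0 <= u n) ->
  (is_lim_seq u 0 <-> forall e, 0 < e -> exists N, forall n, (N <= n)%nat -> u n < e).
Proof.
  intros Hu. rewrite <- is_lim_seq_spec. simpl.
  assert (Habs : forall n, Rabs (u n - 0) = u n)
    by (intros n; rewrite Rminus_0_r; apply Rabs_right, Rle_ge, Hu).
  split.
  - intros H e He. destruct (H (mkposreal e He)) as [N HN]. exists N. intros n Hn.
    rewrite <- Habs. apply HN, Hn.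
  - intros H e. destruct (H e (cond_pos e)) as [N HN]. exists N. intros n Hn.
    rewrite Habs. auto.
Qed.

Lemma is_lim_seq_p_infty_ge (u : nat -> R) : is_lim_seq u p_infty <->
  forall K, exists N, forall n, (N <= n)%nat -> K <= u n.
Proof.
  rewrite <- is_lim_seq_spec. split; intros H K.
  - destruct (H K) as [N HN]. exists N. intros n Hn. apply Rlt_le, HN, Hn.
  - destruct (H (K + 1)) as [N HN]. exists N. intros n Hn. specialize (HN n Hn). lra.
Qed.

Lemma INR_eventually_ge (K : R) : exists N, forall n, (N <= n)%nat -> K <= INR n.
Proof. revert K. apply (is_lim_seq_p_infty_ge INR), is_lim_seq_INR. Qed.

Lemma strictly_increasing_ge_id (phi : nat -> nat) :
  (forall n, (phi n < phi (S n))%nat) -> forall n, (n <= phi n)%nat.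
Proof. intros H n. induction n; [lia|]. specialize (H n). lia. Qed.

Lemma is_lim_seq_comp_ge_id (u : nat -> R) (l : Rbar) (phi : nat -> nat) :
  (forall n, (n <= phi n)%nat) -> is_lim_seq u l -> is_lim_seq (fun n => u (phi n)) l.
Proof.
  intros Hphi. apply is_lim_seq_subseq. intros P [N HN]. exists N. intros n Hn.
  apply HN. specialize (Hphi n). lia.
Qed.

Definition interleave {X : Type} (u v : nat -> X) (n : nat) : X :=
  if Nat.even n then u (Nat.div2 n) else v (Nat.div2 n).

Lemma interleave_even {X : Type} (u v : nat -> X) k : interleave u v (2 * k) = u k.
Proof. unfold interleave. rewrite Nat.even_mul, Nat.div2_double. reflexivity. Qed.

Lemma interleave_odd {X : Type} (u v : nat -> X) k : interleave u v (S (2 * k)) = v k.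
Proof.
  unfold interleave. rewrite Nat.even_succ, Nat.div2_succ_double.
  rewrite <- Nat.negb_even, Nat.even_mul. reflexivity.
Qed.

Lemma interleave_eventually {X : Type} (u v : nat -> X) (P : X -> Prop) N :
  (forall k, (N <= k)%nat -> P (u k) /\ P (v k)) ->
  forall n, (2 * N <= n)%nat -> P (interleave u v n).
Proof.
  intros H n Hn. destruct (Nat.Even_or_Odd n) as [[k ->]|[k ->]].
  - rewrite interleave_even. apply H. lia.
  - rewrite Nat.add_1_r, interleave_odd. apply H. lia.
Qed.

Section BoundarySequences.
Context {X : Type} {D : X -> X -> R} (HD : is_metric D).
Implicit Types (u v w xi : nat -> X) (x y z : X).

Lemma lim_dist_0_iff u v : is_lim_seq (fun n => D (u n) (v n)) 0 <->
  forall e, 0 < e -> exists N, forall n, (N <= n)%nat -> D (u n) (v n) < e.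
Proof. apply is_lim_seq_0_nonneg. intros n. apply (metric_nonneg HD). Qed.

Lemma lim_dist_0_sym u v :
  is_lim_seq (fun n => D (u n) (v n)) 0 -> is_lim_seq (fun n => D (v n) (u n)) 0.
Proof. apply is_lim_seq_ext. intros n. apply (metric_sym HD). Qed.

Lemma lim_dist_0_trans u v w :
  is_lim_seq (fun n => D (u n) (v n)) 0 -> is_lim_seq (fun n => D (v n) (w n)) 0 ->
  is_lim_seq (fun n => D (u n) (w n)) 0.
Proof.
  intros Huv Hvw.
  apply (is_lim_seq_le_le (fun _ => 0) _ (fun n => D (u n) (v n) + D (v n) (w n))).
  - intros n. split; [apply (metric_nonneg HD)|apply (metric_tri HD)].
  - apply is_lim_seq_const.
  - replace 0 with (0 + 0) by ring. apply is_lim_seq_plus'; trivial.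
Qed.

Lemma lim_dist u v x y :
  is_lim_seq (fun n => D (u n) x) 0 -> is_lim_seq (fun n => D (v n) y) 0 ->
  is_lim_seq (fun n => D (u n) (v n)) (D x y).
Proof.
  intros Hu Hv. pose proof (is_lim_seq_plus' _ _ _ _ Hu Hv) as Hsum.
  apply (is_lim_seq_le_le (fun n => D x y - (D (u n) x + D (v n) y)) _
    (fun n => D x y + (D (u n) x + D (v n) y))).
  - intros n. pose proof (metric_tri HD (u n) x (v n)). pose proof (metric_tri HD x y (v n)).
    pose proof (metric_tri HD x (u n) y). pose proof (metric_tri HD (u n) (v n) y).
    rewrite (metric_sym HD x (u n)), (metric_sym HD y (v n)) in *. lra.
  - replace (Finite (D x y)) with (Finite (D x y - (0 + 0))) by (f_equal; ring).
    apply is_lim_seq_minus'; [apply is_lim_seq_const|exact Hsum].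
  - replace (Finite (D x y)) with (Finite (D x y + (0 + 0))) by (f_equal; ring).
    apply is_lim_seq_plus'; [apply is_lim_seq_const|exact Hsum].
Qed.

Lemma cauchy_seq_subseq_converges u phi z :
  cauchy_seq D u -> (forall n, (n <= phi n)%nat) ->
  is_lim_seq (fun n => D (u (phi n)) z) 0 -> converges_in D u.
Proof.
  intros Hu Hphi Hz. exists z.
  apply (lim_dist_0_trans u (fun n => u (phi n)) (fun _ => z)); trivial.
  apply lim_dist_0_iff. intros e He. destruct (Hu e He) as [N HN].
  exists N. intros n Hn. apply HN; [exact Hn|]. specialize (Hphi n). lia.
Qed.

Lemma cauchy_seq_interleave u v : cauchy_seq D u ->
  is_lim_seq (fun n => D (u n) (v n)) 0 -> cauchy_seq D (interleave u v).
Proof.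
  intros Hu Huv e He. destruct (Hu (e / 4) ltac:(lra)) as [N1 HN1].
  destruct (proj1 (lim_dist_0_iff u v) Huv (e / 4) ltac:(lra)) as [N2 HN2].
  set (N := Nat.max N1 N2).
  assert (Hnear : forall n, (2 * N <= n)%nat -> D (interleave u v n) (u N) < e / 2).
  { apply (interleave_eventually u v (fun x => D x (u N) < e / 2)). intros k Hk.
    specialize (HN1 k N ltac:(lia) ltac:(lia)). specialize (HN2 k ltac:(lia)).
    pose proof (metric_tri HD (v k) (u k) (u N)) as H. rewrite (metric_sym HD (v k) (u k)) in H.
    split; lra. }
  exists (2 * N)%nat. intros n m Hn Hm. pose proof (Hnear n Hn). pose proof (Hnear m Hm).
  pose proof (metric_tri HD (interleave u v n) (u N) (interleave u v m)).
  rewrite (metric_sym HD (u N)) in *. lra.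
Qed.

Lemma boundary_seq_interleave u v : boundary_seq D u ->
  is_lim_seq (fun n => D (u n) (v n)) 0 -> boundary_seq D (interleave u v).
Proof.
  intros [Hu Hno] Huv. split; [apply cauchy_seq_interleave; trivial|].
  intros [z Hz]. apply Hno. exists z.
  apply (is_lim_seq_ext (fun k => D (interleave u v (2 * k)) z)).
  - intros k. rewrite interleave_even. reflexivity.
  - apply (is_lim_seq_comp_ge_id _ _ (fun k => (2 * k)%nat)) in Hz; trivial. intros k. lia.
Qed.

Lemma dist_to_bpt_lim z xi : cauchy_seq D xi ->
  is_lim_seq (fun m => D z (xi m)) (dist_to_bpt D z xi).
Proof.
  intros Hxi. assert (Hlim : ex_finite_lim_seq (fun m => D z (xi m))).
  { apply ex_lim_seq_cauchy_corr. intros e. destruct (Hxi e (cond_pos e)) as [N HN].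
    exists N. intros n m Hn Hm. specialize (HN n m Hn Hm).
    pose proof (metric_tri HD z (xi n) (xi m)). pose proof (metric_tri HD z (xi m) (xi n)).
    rewrite (metric_sym HD (xi m) (xi n)) in *. apply Rabs_def1; lra. }
  destruct Hlim as [l Hl]. unfold dist_to_bpt. rewrite (is_lim_seq_unique _ _ Hl). exact Hl.
Qed.

Lemma dist_to_bpt_le z xi b N : cauchy_seq D xi ->
  (forall m, (N <= m)%nat -> D z (xi m) <= b) -> dist_to_bpt D z xi <= b.
Proof.
  intros Hxi Hb.
  apply (is_lim_seq_le_loc (fun m => D z (xi m)) (fun _ => b) (dist_to_bpt D z xi) b).
  - exists N. exact Hb.
  - apply dist_to_bpt_lim, Hxi.
  - apply is_lim_seq_const.
Qed.

Lemma dist_to_bpt_ge z xi b N : cauchy_seq D xi ->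
  (forall m, (N <= m)%nat -> b <= D z (xi m)) -> b <= dist_to_bpt D z xi.
Proof.
  intros Hxi Hb.
  apply (is_lim_seq_le_loc (fun _ => b) (fun m => D z (xi m)) b (dist_to_bpt D z xi)).
  - exists N. exact Hb.
  - apply is_lim_seq_const.
  - apply dist_to_bpt_lim, Hxi.
Qed.

Lemma lim_dist_to_bpt_0 u xi : cauchy_seq D xi ->
  (forall e, 0 < e -> exists N, forall n m, (N <= n)%nat -> (N <= m)%nat -> D (u n) (xi m) < e) ->
  is_lim_seq (fun n => dist_to_bpt D (u n) xi) 0.
Proof.
  intros Hxi Hu. apply is_lim_seq_0_nonneg.
  - intros n. apply (dist_to_bpt_ge (u n) xi 0 0 Hxi). intros; apply (metric_nonneg HD).
  - intros e He. destruct (Hu (e / 2) ltac:(lra)) as [N HN]. exists N. intros n Hn.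
    apply Rle_lt_trans with (e / 2); [|lra].
    apply (dist_to_bpt_le _ _ _ N Hxi). intros m Hm. apply Rlt_le, HN; trivial.
Qed.

Lemma cauchy_seq_lim_dist_to_bpt xi : cauchy_seq D xi ->
  is_lim_seq (fun n => dist_to_bpt D (xi n) xi) 0.
Proof. intros Hxi. apply lim_dist_to_bpt_0; trivial. Qed.

End BoundarySequences.

(** * Limits of geodesics *)

Lemma diagonal_subsequence {X : Type} (D : X -> X -> R) (h : nat -> nat -> X) x (r : nat -> R) :
  (forall k, closed_ball_compact D x (r k)) -> (forall k n, D x (h k n) <= r k) ->
  exists phi z, (forall n, (n <= phi n)%nat) /\
    forall k, is_lim_seq (fun n => D (h k (phi n)) (z k)) 0.
Proof.
  intros Hcompact Hball.
  destruct (functional_choice (fun (kf : nat * (nat -> nat)) (pz : (nat -> nat) * X) =>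
    (forall n, (n <= fst pz n)%nat) /\
    is_lim_seq (fun n => D (h (fst kf) (snd kf (fst pz n))) (snd pz)) 0)) as [step Hstep].
  { intros [k f]. destruct (Hcompact k (fun n => h k (f n))) as (psi & z & Hpsi & _ & Hz);
      [intros n; apply Hball|].
    exists (psi, z). split; [apply strictly_increasing_ge_id, Hpsi|exact Hz]. }
  set (F := fix F k := match k with
    O => fun n => n | S j => fun n => F j (fst (step (j, F j)) n) end).
  assert (Hnest : forall k j n, (k <= j)%nat -> exists m, (n <= m)%nat /\ F j n = F k m).
  { intros k j n Hkj. revert n. induction Hkj as [|j Hkj IH]; intros n; [eauto|].
    destruct (IH (fst (step (j, F j)) n)) as (m & Hm & HF). exists m. split; [|exact HF].
    etransitivity; [apply (Hstep (j, F j))|exact Hm]. }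
  exists (fun n => F n n), (fun k => snd (step (k, F k))). split.
  - intros n. destruct (Hnest O n n ltac:(lia)) as (m & Hm & ->). exact Hm.
  - intros k. apply is_lim_seq_spec. intros e.
    destruct (proj2 (is_lim_seq_spec _ _) (proj2 (Hstep (k, F k))) e) as [N HN].
    exists (Nat.max (S k) N). intros n Hn.
    destruct (Hnest (S k) n n ltac:(lia)) as (m & Hm & ->). apply (HN m). lia.
Qed.

Section RayLimit.
Context {X : Type} {d : X -> X -> R} {p : X}.
Hypothesis Hd : is_metric d.
Hypothesis Hgeod : geodesic_space d.
Hypothesis Hproper : proper_space d.

Lemma is_ray_of_lipschitz g : g 0 = p ->
  (forall s t, 0 <= s -> s <= t -> d (g s) (g t) <= t - s) ->
  (forall n, INR n <= d p (g (INR n))) -> is_ray d g p.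
Proof.
  intros H0 Hlip Hfar. split; trivial.
  assert (Hle : forall s t, 0 <= s -> s <= t -> d (g s) (g t) = t - s).
  { intros s t Hs Hst. apply Rle_antisym; [auto|].
    destruct (INR_eventually_ge t) as [N HN]. specialize (HN N (le_n N)).
    pose proof (Hfar N) as H. pose proof (Hlip 0 s ltac:(lra) Hs) as H0s. rewrite H0 in H0s.
    pose proof (Hlip t (INR N) ltac:(lra) HN).
    pose proof (metric_tri Hd p (g s) (g (INR N))).
    pose proof (metric_tri Hd (g s) (g t) (g (INR N))). lra. }
  intros s t Hs Ht. destruct (Rle_dec s t).
  - rewrite Hle by lra. rewrite Rabs_left1; lra.
  - rewrite (metric_sym Hd), Hle by lra. rewrite Rabs_right; lra.
Qed.

Lemma lipschitz_of_unit_intervals g L :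
  (forall k s t, INR k <= s -> s <= t -> t <= INR k + 1 -> d (g s) (g t) <= L * (t - s)) ->
  forall s t, 0 <= s -> s <= t -> d (g s) (g t) <= L * (t - s).
Proof.
  intros Hunit s t Hs Hst. destruct (INR_eventually_ge t) as [n Hn]. specialize (Hn n (le_n n)).
  revert s t Hs Hst Hn. induction n as [|n IH]; intros s t Hs Hst Hn.
  - apply (Hunit O); simpl in *; lra.
  - rewrite S_INR in Hn. destruct (Rle_dec t (INR n)); [auto|].
    destruct (Rle_dec (INR n) s); [apply (Hunit n); lra|].
    pose proof (IH s (INR n) Hs ltac:(lra) (Rle_refl _)).
    pose proof (Hunit n (INR n) t (Rle_refl _) ltac:(lra) Hn).
    pose proof (metric_tri Hd (g s) (g (INR n)) (g t)). lra.
Qed.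

Lemma ray_through_integer_points (z : nat -> X) : z O = p ->
  (forall i j, d (z i) (z j) = Rabs (INR i - INR j)) ->
  exists g, is_ray d g p /\ forall k, g (INR k) = z k.
Proof.
  intros Hz0 Hz.
  destruct (functional_choice (fun k G => is_geodesic d G (z k) (z (S k)))) as [G HG];
    [intros k; apply Hgeod|].
  set (floor := fun t => proj1_sig (nfloor_ex (Rabs t) (Rabs_pos t))).
  set (g := fun t => G (floor t) (t - INR (floor t))).
  assert (Hunit : forall k, d (z k) (z (S k)) = 1)
    by (intros k; rewrite Hz, S_INR, Rabs_left; lra).
  assert (Hg : forall k s, INR k <= s <= INR k + 1 -> g s = G k (s - INR k)).
  { intros k s Hs. unfold g, floor. destruct (nfloor_ex (Rabs s) (Rabs_pos s)) as [m Hm]. simpl.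
    pose proof (pos_INR k). rewrite Rabs_right in Hm by lra.
    assert (Hkm : INR k < INR (S m)) by (rewrite S_INR; lra).
    assert (Hmk : INR m <= INR (S k)) by (rewrite S_INR; lra).
    apply INR_lt in Hkm. apply INR_le in Hmk.
    destruct (Nat.eq_dec m k) as [->|Hne]; trivial. assert (Hm' : m = S k) by lia. subst m.
    rewrite S_INR in *. replace s with (INR k + 1) by lra.
    replace (INR k + 1 - INR k) with (d (z k) (z (S k))) by (rewrite Hunit; ring).
    rewrite Rminus_diag. destruct (HG k) as (_ & -> & _). apply HG. }
  assert (Hint : forall k, g (INR k) = z k).
  { intros k. rewrite (Hg k) by lra. rewrite Rminus_diag. apply HG. }
  exists g. split; trivial. apply is_ray_of_lipschitz.
  - rewrite <- Hz0. apply (Hint O).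
  - intros s t. rewrite <- (Rmult_1_l (t - s)). apply lipschitz_of_unit_intervals.
    clear s t. intros k s t Hs Hst Ht. destruct (HG k) as (_ & _ & Hiso). rewrite Hunit in Hiso.
    rewrite !(Hg k), Hiso by lra. rewrite Rabs_left1; lra.
  - intros n. rewrite Hint, <- Hz0, Hz. simpl. rewrite Rminus_0_l, Rabs_Ropp. apply Rle_abs.
Qed.

Lemma geodesics_subconverge_to_ray (G : nat -> R -> X) (x : nat -> X) :
  (forall n, is_geodesic d (G n) p (x n)) -> is_lim_seq (fun n => d p (x n)) p_infty ->
  exists g phi, is_ray d g p /\ (forall n, (n <= phi n)%nat) /\
    forall k, is_lim_seq (fun n => d (G (phi n) (INR k)) (g (INR k))) 0.
Proof.
  intros HG Hx.
  set (h := fun k n => G n (Rmin (INR k) (d p (x n)))).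
  assert (Hdom : forall k n, 0 <= Rmin (INR k) (d p (x n)) <= d p (x n)).
  { intros k n. split; [|apply Rmin_r].
    apply Rmin_glb; [apply pos_INR|apply (metric_nonneg Hd)]. }
  assert (Hball : forall k n, d p (h k n) <= INR k).
  { intros k n. specialize (Hdom k n). pose proof (Rmin_l (INR k) (d p (x n))).
    destruct (HG n) as (G0 & _ & Hiso). rewrite <- G0 at 1. unfold h.
    rewrite Hiso by lra. rewrite Rabs_left1; lra. }
  destruct (diagonal_subsequence d h p INR) as (phi & z & Hphi & Hz);
    [intros k; apply Hproper|exact Hball|].
  assert (Hlong : forall k, eventually (fun n => INR k <= d p (x (phi n)))).
  { intros k. apply (is_lim_seq_comp_ge_id _ _ phi Hphi) in Hx.
    apply (proj1 (is_lim_seq_p_infty_ge _) Hx). }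
  assert (Hdist : forall i j, d (z i) (z j) = Rabs (INR i - INR j)).
  { intros i j. apply Rbar_finite_eq.
    rewrite <- (is_lim_seq_unique _ _ (lim_dist Hd _ _ _ _ (Hz i) (Hz j))).
    apply is_lim_seq_unique, is_lim_seq_ext_loc with (fun _ => Rabs (INR i - INR j)).
    - generalize (filter_and _ _ (Hlong i) (Hlong j)). apply filter_imp. intros n [Hi Hj].
      destruct (HG (phi n)) as (_ & _ & Hiso). unfold h. rewrite Hiso by apply Hdom.
      rewrite !Rmin_left by assumption. reflexivity.
    - apply is_lim_seq_const. }
  destruct (ray_through_integer_points z) as (g & Hg & Hgz); trivial.
  { symmetry. apply (proj1 (proj2 Hd)), Rle_antisym; [|apply (metric_nonneg Hd)].
    apply (is_lim_seq_le (fun n => d p (h O (phi n))) (fun _ => 0) (d p (z O)) 0).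
    - intros n. apply (Hball O).
    - apply (lim_dist Hd (fun _ => p)); [|apply Hz].
      rewrite (metric_refl Hd). apply is_lim_seq_const.
    - apply is_lim_seq_const. }
  exists g, phi. split; [|split]; trivial. intros k. rewrite Hgz.
  apply (is_lim_seq_ext_loc (fun n => d (h k (phi n)) (z k))); [|apply Hz].
  generalize (Hlong k). apply filter_imp. intros n Hn. unfold h. rewrite Rmin_left; trivial.
Qed.

End RayLimit.

(** * Gromov products and the uniformized metric *)

Definition gehring_hayman_along {X : Type} (d de : X -> X -> R) (u : nat -> X) : Prop :=
  exists C, 1 <= C /\ forall n m g, is_geodesic d g (u n) (u m) ->
    Rbar_le (curve_length de g 0 (d (u n) (u m))) (Finite (C * de (u n) (u m))).

(* On Gromov sequences this is the usual equivalence [(u_n|v_n) -> oo]; with two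
   indices a sequence is Gromov iff it is equivalent to itself. *)
Definition gromov_equiv {X : Type} (d : X -> X -> R) (p : X) (u v : nat -> X) : Prop :=
  forall K, exists N, forall n m, (N <= n)%nat -> (N <= m)%nat ->
    K <= gromov_product d p (u n) (v m).

Section Uniformization.
Context {X : Type} {d : X -> X -> R} {p : X}.
Hypothesis Hd : is_metric d.

Notation gp := (gromov_product d p).

Lemma gromov_product_sym x y : gp x y = gp y x.
Proof. unfold gromov_product. rewrite (metric_sym Hd x y). lra. Qed.

Lemma gromov_product_self x : gp x x = d p x.
Proof. unfold gromov_product. rewrite (metric_refl Hd). lra. Qed.

Lemma gromov_product_nonneg x y : 0 <= gp x y.
Proof.
  unfold gromov_product. pose proof (metric_tri Hd x p y).
  rewrite (metric_sym Hd x p) in *. lra.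
Qed.

Lemma gromov_product_le_dist x y : gp x y <= d p x.
Proof. unfold gromov_product. pose proof (metric_tri Hd p x y). lra. Qed.

Lemma gromov_product_lipschitz x y z : gp x y - d y z <= gp x z.
Proof.
  unfold gromov_product. pose proof (metric_tri Hd p z y). pose proof (metric_tri Hd x y z).
  rewrite (metric_sym Hd z y) in *. lra.
Qed.

Lemma gromov_product_ge_dist x y : d p x - d x y <= gp x y.
Proof. rewrite <- gromov_product_self. apply gromov_product_lipschitz. Qed.

Lemma geodesic_isometric_on g x y : is_geodesic d g x y -> isometric_on d g 0 (d x y).
Proof. intros (_ & _ & H). exact H. Qed.

Lemma geodesic_dist_endpoints g x y s : is_geodesic d g x y -> 0 <= s <= d x y ->
  d x (g s) = s /\ d (g s) y = d x y - s.
Proof.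
  intros Hg Hs. pose proof (geodesic_isometric_on g x y Hg) as Hiso.
  destruct Hg as (G0 & G1 & _). split.
  - rewrite <- G0 at 1. rewrite (isometric_on_dist g 0 (d x y)); trivial; lra.
  - rewrite <- G1 at 1. apply (isometric_on_dist g 0 (d x y)); trivial; lra.
Qed.

Lemma geodesic_reverse g x y :
  is_geodesic d g x y -> is_geodesic d (fun s => g (d x y - s)) y x.
Proof.
  intros (G0 & G1 & Hiso). unfold is_geodesic. rewrite (metric_sym Hd y x).
  split; [|split].
  - rewrite Rminus_0_r. exact G1.
  - rewrite Rminus_diag. exact G0.
  - intros s t Hs Ht. rewrite Hiso by lra.
    replace (d x y - s - (d x y - t)) with (- (s - t)) by ring. apply Rabs_Ropp.
Qed.

Lemma ray_dist g o s t : is_ray d g o -> 0 <= s -> s <= t -> d (g s) (g t) = t - s.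
Proof. intros [_ H] Hs Hst. rewrite H by lra. rewrite Rabs_left1; lra. Qed.

Lemma ray_dist_origin g o t : is_ray d g o -> 0 <= t -> d o (g t) = t.
Proof.
  intros Hg Ht. rewrite <- (proj1 Hg), (ray_dist g o); trivial; lra.
Qed.

Lemma ray_gromov_product o g s t : is_ray d g o -> 0 <= s -> 0 <= t ->
  Rmin s t - d o p <= gp (g s) (g t).
Proof.
  intros Hg Hs Ht. unfold gromov_product. rewrite (proj2 Hg s t Hs Ht).
  pose proof (metric_tri Hd o p (g s)) as Hos. pose proof (metric_tri Hd o p (g t)) as Hot.
  rewrite (ray_dist_origin g o) in Hos, Hot by trivial.
  unfold Rmin, Rabs. destruct (Rle_dec s t), (Rcase_abs (s - t)); lra.
Qed.

(* The distance from [x] to the point of a geodesic [x,y] nearest to [p], up to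
   the hyperbolicity constant. *)
Definition geodesic_center (x y : X) : R := d p x - gp x y.

Lemma geodesic_center_bounds x y : 0 <= geodesic_center x y <= d x y.
Proof.
  unfold geodesic_center. pose proof (gromov_product_le_dist x y).
  pose proof (gromov_product_ge_dist x y). lra.
Qed.

Lemma geodesic_center_swap x y : geodesic_center y x = d x y - geodesic_center x y.
Proof. unfold geodesic_center, gromov_product. rewrite (metric_sym Hd y x). lra. Qed.

Lemma geodesic_dist_base_ge g x y s : is_geodesic d g x y -> 0 <= s <= d x y ->
  gp x y + Rabs (s - geodesic_center x y) <= d p (g s).
Proof.
  intros Hg Hs. destruct (geodesic_dist_endpoints g x y s Hg Hs) as [Hx Hy].
  pose proof (metric_tri Hd p (g s) x) as Tx. rewrite (metric_sym Hd (g s) x) in Tx.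
  pose proof (metric_tri Hd p (g s) y) as Ty.
  unfold geodesic_center, gromov_product, Rabs. destruct (Rcase_abs _); lra.
Qed.

Lemma gromov_seq_equiv u : gromov_seq d p u <-> gromov_equiv d p u u.
Proof.
  split; intros H K; destruct (H K) as [N HN]; exists N; intros n m Hn Hm;
    [apply Rge_le|apply Rle_ge]; auto.
Qed.

Lemma gromov_equiv_sym u v : gromov_equiv d p u v -> gromov_equiv d p v u.
Proof.
  intros H K. destruct (H K) as [N HN]. exists N. intros n m Hn Hm.
  rewrite gromov_product_sym. auto.
Qed.

Lemma gromov_equiv_comp_l u v phi : (forall n, (n <= phi n)%nat) ->
  gromov_equiv d p u v -> gromov_equiv d p (fun n => u (phi n)) v.
Proof.
  intros Hphi H K. destruct (H K) as [N HN]. exists N. intros n m Hn Hm.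
  apply HN; trivial. specialize (Hphi n). lia.
Qed.

Lemma gromov_equiv_interleave u v w : gromov_equiv d p u w -> gromov_equiv d p v w ->
  gromov_equiv d p (interleave u v) w.
Proof.
  intros Hu Hv K. destruct (Hu K) as [N1 HN1], (Hv K) as [N2 HN2].
  set (N := Nat.max N1 N2). exists (2 * N)%nat. intros n m Hn Hm.
  revert n Hn. apply (interleave_eventually u v (fun x => K <= gp x (w m))).
  intros k Hk. split; [apply HN1|apply HN2]; lia.
Qed.

Lemma gromov_equiv_of_interleave u v : gromov_seq d p (interleave u v) -> gromov_equiv d p u v.
Proof.
  intros H K. destruct (proj1 (gromov_seq_equiv _) H K) as [N HN]. exists N. intros n m Hn Hm.
  rewrite <- (interleave_even u v n), <- (interleave_odd u v m). apply HN; lia.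
Qed.

Lemma gromov_seq_escapes u : gromov_seq d p u -> is_lim_seq (fun n => d p (u n)) p_infty.
Proof.
  intros Hu. apply is_lim_seq_p_infty_ge. intros K.
  destruct (proj1 (gromov_seq_equiv u) Hu K) as [N HN]. exists N. intros n Hn.
  rewrite <- gromov_product_self. auto.
Qed.

Lemma ray_gromov_seq o g : is_ray d g o -> gromov_seq d p (fun k => g (INR k)).
Proof.
  intros Hg. apply gromov_seq_equiv. intros K.
  destruct (INR_eventually_ge (K + d o p)) as [N HN]. exists N. intros n m Hn Hm.
  pose proof (ray_gromov_product o g _ _ Hg (pos_INR n) (pos_INR m)).
  pose proof (Rmin_glb _ _ _ (HN n Hn) (HN m Hm)). lra.
Qed.

Lemma bounded_rays_gromov_equiv o g g' C : is_ray d g o ->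
  (forall t, 0 <= t -> d (g t) (g' t) <= C) ->
  gromov_equiv d p (fun k => g (INR k)) (fun k => g' (INR k)).
Proof.
  intros Hg HC K. destruct (proj1 (gromov_seq_equiv _) (ray_gromov_seq o g Hg) (K + C)) as [N HN].
  exists N. intros n m Hn Hm. specialize (HN n m Hn Hm). simpl in HN.
  pose proof (gromov_product_lipschitz (g (INR n)) (g (INR m)) (g' (INR m))).
  pose proof (HC (INR m) (pos_INR m)). lra.
Qed.

Context {eps : R}.
Hypothesis Heps : 0 < eps.

Notation rho := (rho_eps d p eps).
Notation de := (dist_eps d p eps).

(* Up to a power, the visual quasimetric on the Gromov boundary. *)
Definition visual (x y : X) : R := exp (- eps * gp x y).

Lemma rho_pos x : 0 < rho x.
Proof. apply exp_pos. Qed.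

Lemma rho_nonneg x : 0 <= rho x.
Proof. apply Rlt_le, rho_pos. Qed.

Lemma rho_le_exp x k : k <= d p x -> rho x <= exp (- eps * k).
Proof. intros H. apply exp_le_compat. nra. Qed.

Lemma rho_le_1 x : rho x <= 1.
Proof.
  rewrite <- exp_0. replace 0 with (- eps * 0) by ring.
  apply rho_le_exp, (metric_nonneg Hd).
Qed.

Lemma rho_harnack x y : rho y <= exp (eps * d x y) * rho x.
Proof.
  unfold rho_eps. rewrite <- exp_plus. apply exp_le_compat.
  pose proof (metric_tri Hd p y x). rewrite (metric_sym Hd y x) in *. nra.
Qed.

Lemma visual_pos x y : 0 < visual x y.
Proof. apply exp_pos. Qed.

Lemma visual_sym x y : visual x y = visual y x.
Proof. unfold visual. rewrite gromov_product_sym. reflexivity. Qed.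

Lemma visual_self x : visual x x = rho x.
Proof. unfold visual. rewrite gromov_product_self. reflexivity. Qed.

Lemma visual_le_exp x y k : k <= gp x y -> visual x y <= exp (- eps * k).
Proof. intros H. apply exp_le_compat. nra. Qed.

Lemma gromov_product_gt_of_visual x y k : visual x y < exp (- eps * k) -> k < gp x y.
Proof. intros H. apply exp_lt_inv in H. nra. Qed.

Lemma visual_le_1 x y : visual x y <= 1.
Proof.
  rewrite <- exp_0. replace 0 with (- eps * 0) by ring.
  apply visual_le_exp, gromov_product_nonneg.
Qed.

Lemma visual_lipschitz x y z : visual x z <= exp (eps * d y z) * visual x y.
Proof.
  unfold visual. rewrite <- exp_plus. apply exp_le_compat.
  pose proof (gromov_product_lipschitz x y z). nra.
Qed.

Lemma exists_exp_lt e : 0 < e -> exists K, exp (- eps * K) < e.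
Proof.
  intros He. exists (- ln (e / 2) / eps).
  replace (- eps * (- ln (e / 2) / eps)) with (ln (e / 2)) by (field; lra).
  rewrite exp_ln; lra.
Qed.

Hypothesis Hgeod : geodesic_space d.

Lemma dist_eps_le_dist x y : de x y <= d x y.
Proof.
  pose proof (density_dist_le_dist Hd rho_nonneg Hgeod rho_le_1 x y) as H.
  rewrite Rmult_1_l in H. exact H.
Qed.

Lemma dist_eps_ge x y : exp (-1) * rho x * Rmin (/ eps) (d x y) <= de x y.
Proof.
  assert (Hinv : 0 < / eps) by (apply Rinv_0_lt_compat, Heps).
  apply (density_dist_ge Hd rho_nonneg Hgeod rho_le_1).
  - apply Rmult_le_pos; [apply Rlt_le, exp_pos|apply rho_nonneg].
  - split; [|apply Rmin_r]. apply Rmin_glb; [lra|apply (metric_nonneg Hd)].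
  - intros z Hz. pose proof (rho_harnack z x) as H. rewrite (metric_sym Hd z x) in H.
    assert (Hexp : exp (eps * d x z) <= exp 1).
    { apply exp_le_compat. pose proof (Rmin_l (/ eps) (d x y)).
      rewrite <- (Rinv_r eps) by lra. apply Rmult_le_compat_l; lra. }
    replace (rho z) with (exp (-1) * (exp 1 * rho z))
      by (rewrite <- Rmult_assoc, <- exp_plus; replace (-1 + 1) with 0 by ring;
          rewrite exp_0; ring).
    apply Rmult_le_compat_l; [apply Rlt_le, exp_pos|].
    eapply Rle_trans; [exact H|]. apply Rmult_le_compat_r; [apply rho_nonneg|exact Hexp].
Qed.

Lemma dist_eps_ge_far R : 0 < R -> exists k, 0 < k /\
  forall x y, R <= d x y -> k * rho x <= de x y.
Proof.
  intros HR. assert (Hinv : 0 < / eps) by (apply Rinv_0_lt_compat, Heps).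
  exists (exp (-1) * Rmin (/ eps) R). split.
  - apply Rmult_lt_0_compat; [apply exp_pos|apply Rmin_glb_lt; trivial].
  - intros x y Hxy. eapply Rle_trans; [|apply dist_eps_ge].
    rewrite Rmult_assoc, (Rmult_comm _ (rho x)), <- Rmult_assoc.
    apply Rmult_le_compat_l; [|apply Rle_min_compat_l, Hxy].
    apply Rmult_le_pos; [apply Rlt_le, exp_pos|apply rho_nonneg].
Qed.

Lemma dist_eps_ge_near R : 0 < R -> exists k, 0 < k /\
  forall x y, d x y <= R -> k * (rho x * d x y) <= de x y.
Proof.
  intros HR. assert (Hinv : 0 < / eps / R)
    by (apply Rdiv_lt_0_compat; trivial; apply Rinv_0_lt_compat, Heps).
  set (m := Rmin (/ eps / R) 1). assert (Hm : 0 < m) by (apply Rmin_glb_lt; lra).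
  exists (exp (-1) * m). split; [apply Rmult_lt_0_compat; trivial; apply exp_pos|].
  intros x y Hxy. pose proof (metric_nonneg Hd x y) as H0.
  eapply Rle_trans; [|apply dist_eps_ge].
  replace (exp (-1) * m * (rho x * d x y)) with (exp (-1) * rho x * (m * d x y)) by ring.
  apply Rmult_le_compat_l.
  - apply Rmult_le_pos; [apply Rlt_le, exp_pos|apply rho_nonneg].
  - apply Rmin_glb.
    + replace (/ eps) with (/ eps / R * R) by (field; lra).
      apply Rmult_le_compat; trivial; [lra|apply Rmin_l].
    + assert (m <= 1) by apply Rmin_r. nra.
Qed.

Lemma dist_eps_metric : is_metric de.
Proof.
  split; [|split; [|split]].
  - exact (density_dist_nonneg Hd rho_nonneg Hgeod rho_le_1).
  - intros x y. split.
    + intros H. pose proof (dist_eps_ge x y) as Hge. rewrite H in Hge.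
      assert (Hr : 0 < exp (-1) * rho x)
        by (apply Rmult_lt_0_compat; [apply exp_pos|apply rho_pos]).
      assert (Hinv : 0 < / eps) by (apply Rinv_0_lt_compat, Heps).
      apply (proj1 (proj2 Hd)), Rle_antisym; [|apply (metric_nonneg Hd)].
      apply Rnot_lt_le. intros Hlt. pose proof (Rmin_glb_lt _ _ _ Hinv Hlt). nra.
    + intros ->. exact (density_dist_refl Hd rho_nonneg Hgeod rho_le_1 y).
  - exact (density_dist_sym Hd rho_nonneg Hgeod rho_le_1).
  - exact (density_dist_tri Hd rho_nonneg Hgeod rho_le_1).
Qed.

Lemma lim_dist_eps_of_lim_dist u z :
  is_lim_seq (fun n => d (u n) z) 0 -> is_lim_seq (fun n => de (u n) z) 0.
Proof.
  apply is_lim_seq_le_le with (fun _ => 0); [|apply is_lim_seq_const].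
  intros n. split; [apply (metric_nonneg dist_eps_metric)|apply dist_eps_le_dist].
Qed.

Lemma is_curve_of_dist_eps g a b : is_curve de g a b -> is_curve d g a b.
Proof.
  intros [Hab Hcont]. split; trivial. intros t Ht e He.
  destruct (dist_eps_ge_far e He) as (k & Hk & Hfar).
  destruct (Hcont t Ht (k * rho (g t))) as (eta & Heta & Hnear);
    [apply Rmult_lt_0_compat; trivial; apply rho_pos|].
  exists eta. split; trivial. intros s Hs Hst. specialize (Hnear s Hs Hst).
  apply Rnot_le_lt. intros Hle. rewrite (metric_sym Hd) in Hle.
  pose proof (Hfar (g t) (g s) Hle). rewrite (metric_sym dist_eps_metric) in Hnear. lra.
Qed.

Lemma is_geodesic_curve_dist_eps g x y : is_geodesic d g x y -> is_curve de g 0 (d x y).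
Proof.
  intros (_ & _ & Hiso). split; [apply (metric_nonneg Hd)|].
  intros t Ht e He. exists e. split; trivial. intros s Hs Hst.
  eapply Rle_lt_trans; [apply dist_eps_le_dist|]. rewrite Hiso; trivial.
Qed.

Lemma isometric_on_length_le_exp g u v K lam : lam <> 0 -> isometric_on d g u v ->
  (forall s, u <= s <= v -> rho (g s) <= K * exp (lam * s)) ->
  Rbar_le (curve_length de g u v) (Finite (K / lam * exp (lam * v) - K / lam * exp (lam * u))).
Proof.
  intros Hlam Hg Hrho.
  apply (isometric_on_density_length_le Hd rho_nonneg g u v (fun s => K * exp (lam * s))
    (fun s => K / lam * exp (lam * s))); trivial.
  intros s _. auto_derive; trivial. field. exact Hlam.
Qed.

Lemma geodesic_initial_length_le g x y t : is_geodesic d g x y ->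
  0 <= t <= geodesic_center x y ->
  Rbar_le (curve_length de g 0 t)
    (Finite (visual x y * exp (- eps * (geodesic_center x y - t)) / eps)).
Proof.
  intros Hg Ht. pose proof (geodesic_center_bounds x y). set (c := geodesic_center x y) in *.
  set (K := visual x y * exp (- eps * c)).
  eapply Rbar_le_trans; [apply (isometric_on_length_le_exp g 0 t K eps)|].
  - lra.
  - apply (isometric_on_sub g 0 (d x y)); [lra|lra|apply geodesic_isometric_on, Hg].
  - intros s Hs. unfold K, visual. rewrite <- !exp_plus.
    eapply Rle_trans; [apply rho_le_exp, (geodesic_dist_base_ge g x y s Hg); lra|].
    fold c. rewrite Rabs_left1 by lra. right. f_equal. ring.
  - simpl. assert (0 <= K / eps * exp (eps * 0)).
    { apply Rmult_le_pos; [apply Rdiv_le_0_compat; trivial|apply Rlt_le, exp_pos].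
      apply Rlt_le, Rmult_lt_0_compat; apply exp_pos. }
    replace (- eps * (c - t)) with (- eps * c + eps * t) by ring. rewrite exp_plus.
    replace (visual x y * (exp (- eps * c) * exp (eps * t)) / eps)
      with (K / eps * exp (eps * t)) by (unfold K; field; lra).
    lra.
Qed.

Lemma geodesic_final_length_le g x y t : is_geodesic d g x y ->
  geodesic_center x y <= t <= d x y ->
  Rbar_le (curve_length de g t (d x y))
    (Finite (visual x y * exp (- eps * (t - geodesic_center x y)) / eps)).
Proof.
  intros Hg Ht.
  pose proof (geodesic_initial_length_le _ y x (d x y - t) (geodesic_reverse g x y Hg)) as H.
  rewrite geodesic_center_swap, (visual_sym y x), (curve_length_reflect dist_eps_metric) in H.
  replace (d x y - (d x y - t)) with t in H by ring. rewrite Rminus_0_r in H.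
  replace (d x y - geodesic_center x y - (d x y - t)) with (t - geodesic_center x y) in H by ring.
  apply H. lra.
Qed.

Lemma geodesic_length_le g x y : is_geodesic d g x y ->
  Rbar_le (curve_length de g 0 (d x y)) (Finite (2 / eps * visual x y)).
Proof.
  intros Hg. pose proof (geodesic_center_bounds x y) as Hc.
  pose proof (geodesic_initial_length_le g x y _ Hg (conj (proj1 Hc) (Rle_refl _))) as Hinit.
  pose proof (geodesic_final_length_le g x y _ Hg (conj (Rle_refl _) (proj2 Hc))) as Hfinal.
  rewrite Rminus_diag, Rmult_0_r, exp_0, Rmult_1_r in Hinit, Hfinal.
  replace (2 / eps * visual x y) with (visual x y / eps + visual x y / eps) by (field; lra).
  apply (curve_length_cat dist_eps_metric g 0 (geodesic_center x y)); trivial.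
Qed.

Lemma dist_eps_le_visual x y : de x y <= 2 / eps * visual x y.
Proof.
  destruct (Hgeod x y) as [g Hg].
  pose proof (Rbar_le_trans _ _ _ (curve_length_ge_dist (D := de) g 0 (d x y)
    (metric_nonneg Hd x y)) (geodesic_length_le g x y Hg)) as H.
  destruct Hg as (G0 & G1 & _). rewrite G0, G1 in H. exact H.
Qed.

Lemma geodesic_length_le_near g x y R : is_geodesic d g x y -> d x y <= R ->
  Rbar_le (curve_length de g 0 (d x y)) (Finite (exp (eps * R) * (rho x * d x y))).
Proof.
  intros Hg HR. set (K := exp (eps * R) * rho x).
  replace (exp (eps * R) * (rho x * d x y)) with (K * d x y - K * 0) by (unfold K; ring).
  apply (isometric_on_density_length_le Hd rho_nonneg g 0 (d x y) (fun _ => K)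
    (fun s => K * s)).
  - apply geodesic_isometric_on, Hg.
  - intros s _. auto_derive; trivial. ring.
  - intros s Hs. eapply Rle_trans; [apply (rho_harnack x)|].
    apply Rmult_le_compat_r; [apply rho_nonneg|]. apply exp_le_compat.
    rewrite (proj1 (geodesic_dist_endpoints g x y s Hg Hs)). apply Rmult_le_compat_l; lra.
Qed.

Lemma GH_theorem_of_visual_le c R : 0 < c -> 0 < R ->
  (forall x y, R < d x y -> c * visual x y <= de x y) -> GH_theorem d de.
Proof.
  intros Hc HR Hfar. destruct (dist_eps_ge_near R HR) as (k & Hk & Hnear).
  assert (Cfar : 0 < 2 / eps / c) by (repeat apply Rdiv_lt_0_compat; lra).
  assert (Cnear : 0 < exp (eps * R) / k) by (apply Rdiv_lt_0_compat; trivial; apply exp_pos).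
  exists (2 / eps / c + exp (eps * R) / k). split; [lra|].
  intros x y g Hg. pose proof (metric_nonneg dist_eps_metric x y) as He.
  destruct (Rlt_dec R (d x y)) as [Hlt|Hge].
  - eapply Rbar_le_trans; [apply geodesic_length_le, Hg|]. simpl.
    apply Rle_trans with (2 / eps / c * de x y); [|nra].
    replace (2 / eps * visual x y) with (2 / eps / c * (c * visual x y)) by (field; lra).
    apply Rmult_le_compat_l; [lra|apply Hfar, Hlt].
  - eapply Rbar_le_trans; [apply (geodesic_length_le_near g x y R Hg); lra|]. simpl.
    apply Rle_trans with (exp (eps * R) / k * de x y); [|nra].
    replace (exp (eps * R) * (rho x * d x y)) with
      (exp (eps * R) / k * (k * (rho x * d x y))) by (field; lra).
    apply Rmult_le_compat_l; [lra|apply Hnear; lra].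
Qed.

Lemma dist_eps_small_of_gromov_product e : 0 < e ->
  exists K, forall x y, K <= gp x y -> de x y < e.
Proof.
  intros He. destruct (exists_exp_lt (e * eps / 2)) as [K HK].
  { apply Rdiv_lt_0_compat; [apply Rmult_lt_0_compat|]; lra. }
  exists K. intros x y Hxy. eapply Rle_lt_trans; [apply dist_eps_le_visual|].
  replace e with (2 / eps * (e * eps / 2)) by (field; lra).
  apply Rmult_lt_compat_l; [apply Rdiv_lt_0_compat; lra|].
  eapply Rle_lt_trans; [apply visual_le_exp, Hxy|exact HK].
Qed.

Lemma gromov_equiv_dist_eps_small u v : gromov_equiv d p u v -> forall e, 0 < e ->
  exists N, forall n m, (N <= n)%nat -> (N <= m)%nat -> de (u n) (v m) < e.
Proof.
  intros Huv e He. destruct (dist_eps_small_of_gromov_product e He) as [K HK].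
  destruct (Huv K) as [N HN]. exists N. auto.
Qed.

Lemma gromov_equiv_lim_dist_eps u v :
  gromov_equiv d p u v -> is_lim_seq (fun n => de (u n) (v n)) 0.
Proof.
  intros Huv. apply (lim_dist_0_iff dist_eps_metric). intros e He.
  destruct (gromov_equiv_dist_eps_small u v Huv e He) as [N HN]. exists N. auto.
Qed.

Lemma far_pairs_escape x y R : 0 < R -> (forall n : nat, R <= d (x n) (y n)) ->
  is_lim_seq (fun n => de (x n) (y n)) 0 -> is_lim_seq (fun n => d p (x n)) p_infty.
Proof.
  intros HR Hfar Hlim. destruct (dist_eps_ge_far R HR) as (k & Hk & Hge).
  apply is_lim_seq_p_infty_ge. intros K.
  destruct (proj1 (lim_dist_0_iff dist_eps_metric x y) Hlim (k * exp (- eps * K))) as [N HN].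
  { apply Rmult_lt_0_compat; trivial. apply exp_pos. }
  exists N. intros n Hn. specialize (HN n Hn). pose proof (Hge _ _ (Hfar n)).
  assert (Hrho : rho (x n) < exp (- eps * K)) by nra.
  apply exp_lt_inv in Hrho. nra.
Qed.

Lemma gromov_seq_boundary u : gromov_seq d p u -> boundary_seq de u.
Proof.
  intros Hu. split; [exact (gromov_equiv_dist_eps_small u u (proj1 (gromov_seq_equiv u) Hu))|].
  intros [z Hz]. destruct (dist_eps_ge_far 1 Rlt_0_1) as (k & Hk & Hge).
  destruct (proj1 (lim_dist_0_iff dist_eps_metric u (fun _ => z)) Hz (k * rho z)) as [N1 HN1].
  { apply Rmult_lt_0_compat; trivial. apply rho_pos. }
  destruct (proj1 (is_lim_seq_p_infty_ge _) (gromov_seq_escapes u Hu) (d p z + 1)) as [N2 HN2].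
  set (n := Nat.max N1 N2). specialize (HN1 n ltac:(lia)). specialize (HN2 n ltac:(lia)).
  rewrite (metric_sym dist_eps_metric) in HN1.
  pose proof (metric_tri Hd p z (u n)). pose proof (Hge z (u n) ltac:(lra)). lra.
Qed.

Lemma ray_boundary_seq o g : is_ray d g o -> boundary_seq de (fun k => g (INR k)).
Proof. intros Hg. apply gromov_seq_boundary, (ray_gromov_seq o), Hg. Qed.

Hypothesis Hproper : proper_space d.

Lemma boundary_seq_escapes xi :
  boundary_seq de xi -> is_lim_seq (fun n => d p (xi n)) p_infty.
Proof.
  intros [Hcauchy Hno]. apply is_lim_seq_p_infty_ge. intros K. apply NNPP. intros Hnear.
  apply Hno. assert (Hf : forall N, exists n, (N <= n)%nat /\ d p (xi n) <= K).
  { intros N. apply NNPP. intros H. apply Hnear. exists N. intros n Hn.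
    apply Rnot_lt_le. intros Hlt. apply H. exists n. split; [exact Hn|lra]. }
  destruct (functional_choice _ Hf) as [f Hf'].
  destruct (Hproper p K (fun n => xi (f n))) as (phi & z & Hphi & _ & Hz); [apply Hf'|].
  pose proof (strictly_increasing_ge_id phi Hphi) as Hge.
  apply (cauchy_seq_subseq_converges dist_eps_metric xi (fun n => f (phi n)) z Hcauchy).
  - intros n. etransitivity; [apply Hge|apply Hf'].
  - apply (lim_dist_eps_of_lim_dist (fun n => xi (f (phi n)))), Hz.
Qed.

Lemma dist_to_boundary_ge :
  exists c, 0 < c /\ forall z, Rbar_le (c * rho z) (dist_to_boundary de z).
Proof.
  destruct (dist_eps_ge_far 1 Rlt_0_1) as (c & Hc & Hge). exists c. split; trivial.
  intros z. apply Glb_Rbar_correct. intros r (xi & Hxi & ->).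
  destruct (proj1 (is_lim_seq_p_infty_ge _) (boundary_seq_escapes xi Hxi) (d p z + 1))
    as [N HN].
  apply (dist_to_bpt_ge dist_eps_metric z xi _ N (proj1 Hxi)).
  intros m Hm. specialize (HN m Hm). apply Hge.
  pose proof (metric_tri Hd p z (xi m)). lra.
Qed.

Lemma dist_eps_locally_compact : locally_compact de.
Proof.
  intros x. destruct (dist_eps_ge_far 1 Rlt_0_1) as (k & Hk & Hge).
  assert (Hr : 0 < k * rho x) by (apply Rmult_lt_0_compat; trivial; apply rho_pos).
  exists (k * rho x / 2). split; [lra|]. intros u Hu.
  destruct (Hproper x 1 u) as (phi & z & Hphi & _ & Hz).
  { intros n. apply Rnot_lt_le. intros Hlt. pose proof (Hge x (u n) ltac:(lra)).
    specialize (Hu n). lra. }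
  apply (lim_dist_eps_of_lim_dist (fun n => u (phi n))) in Hz.
  exists phi, z. split; [trivial|]. split; [|exact Hz].
  apply (is_lim_seq_le (fun n => de x (u (phi n))) (fun _ => k * rho x / 2) (de x z)
    (k * rho x / 2)); [auto| |apply is_lim_seq_const].
  apply (lim_dist dist_eps_metric (fun _ => x) (fun n => u (phi n))); trivial.
  rewrite (metric_refl dist_eps_metric). apply is_lim_seq_const.
Qed.

Context {delta : R}.
Hypothesis Hhyp : forall x y z, Rmin (gp x y) (gp y z) - delta <= gp x z.

Lemma gromov_product_chain x y z k : k <= gp x y -> k <= gp y z -> k - delta <= gp x z.
Proof.
  intros Hxy Hyz. pose proof (Hhyp x y z). pose proof (Rmin_glb _ _ _ Hxy Hyz). lra.
Qed.

Lemma hyperbolicity_constant_nonneg : 0 <= delta.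
Proof. pose proof (gromov_product_chain p p p _ (Rle_refl _) (Rle_refl _)). lra. Qed.

Lemma visual_quasi_ultrametric x y z k :
  visual x y <= k -> visual y z <= k -> visual x z <= exp (eps * delta) * k.
Proof.
  intros Hxy Hyz. pose proof (Hhyp x y z) as H.
  apply Rle_trans with (exp (eps * delta) * exp (- eps * Rmin (gp x y) (gp y z))).
  - rewrite <- exp_plus. apply exp_le_compat. nra.
  - apply Rmult_le_compat_l; [apply Rlt_le, exp_pos|].
    unfold Rmin. destruct (Rle_dec _ _); trivial.
Qed.

Lemma gromov_equiv_trans u v w :
  gromov_equiv d p u v -> gromov_equiv d p v w -> gromov_equiv d p u w.
Proof.
  intros Huv Hvw K. destruct (Huv (K + delta)) as [N1 HN1], (Hvw (K + delta)) as [N2 HN2].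
  set (N := Nat.max N1 N2). exists N. intros n m Hn Hm.
  replace K with (K + delta - delta) by ring.
  apply (gromov_product_chain _ (v N)); [apply HN1|apply HN2]; lia.
Qed.

(* The four-point condition, applied to the point of [x,y] where the two
   Gromov products with [x] and [y] coincide. *)
Lemma geodesic_center_dist_base_le g x y : is_geodesic d g x y ->
  d p (g (geodesic_center x y)) <= gp x y + 2 * delta.
Proof.
  intros Hg.
  destruct (geodesic_dist_endpoints g x y _ Hg (geodesic_center_bounds x y)) as [Hx Hy].
  set (w := g (geodesic_center x y)) in *.
  assert (Hxw : gp x w = (gp x y + d p w) / 2).
  { unfold gromov_product at 1. rewrite Hx. unfold geodesic_center. lra. }
  assert (Hwy : gp w y = (gp x y + d p w) / 2).
  { unfold gromov_product at 1. rewrite Hy. unfold geodesic_center, gromov_product. lra. }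
  pose proof (gromov_product_chain x w y ((gp x y + d p w) / 2)). lra.
Qed.

Lemma geodesic_center_visual_le g x y t : is_geodesic d g x y -> 0 <= t <= d x y ->
  visual x y * exp (- eps * Rabs (t - geodesic_center x y)) <=
  exp (eps * (2 * delta)) * rho (g t).
Proof.
  intros Hg Ht. unfold visual, rho_eps. rewrite <- !exp_plus. apply exp_le_compat.
  pose proof (geodesic_center_dist_base_le g x y Hg).
  pose proof (metric_tri Hd p (g (geodesic_center x y)) (g t)) as Htri.
  rewrite (geodesic_isometric_on g x y Hg _ _ (geodesic_center_bounds x y) Ht),
    Rabs_minus_sym in Htri.
  nra.
Qed.

Lemma geodesic_length_ge R : 0 < R -> exists c, 0 < c /\ forall x y g,
  is_geodesic d g x y -> R <= d x y ->
  Rbar_le (c * visual x y) (curve_length de g 0 (d x y)).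
Proof.
  intros HR. destruct (dist_eps_ge_far (R / 2) ltac:(lra)) as (k & Hk & Hfar).
  exists (k * exp (- (eps * (2 * delta)))).
  split; [apply Rmult_lt_0_compat; trivial; apply exp_pos|].
  intros x y g Hg HRd. pose proof (geodesic_center_bounds x y) as Hc.
  pose proof (geodesic_center_visual_le g x y _ Hg Hc) as Hvis.
  destruct (geodesic_dist_endpoints g x y _ Hg Hc) as [Hx Hy].
  eapply Rbar_le_trans;
    [|apply (curve_length_ge_split (D := de) g 0 (geodesic_center x y)); lra].
  destruct Hg as (-> & -> & _). set (w := g (geodesic_center x y)) in *.
  rewrite Rminus_diag, Rabs_R0, Rmult_0_r, exp_0, Rmult_1_r in Hvis.
  assert (Hrho : k * exp (- (eps * (2 * delta))) * visual x y <= k * rho w).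
  { rewrite Rmult_assoc. apply Rmult_le_compat_l; [lra|]. rewrite exp_Ropp.
    apply Rmult_le_reg_l with (exp (eps * (2 * delta))); [apply exp_pos|].
    rewrite <- Rmult_assoc, Rinv_r, Rmult_1_l by apply exp_neq_0. exact Hvis. }
  pose proof (metric_nonneg dist_eps_metric x w). pose proof (metric_nonneg dist_eps_metric w y).
  rewrite (metric_sym Hd) in Hx. simpl.
  destruct (Rle_dec (R / 2) (geodesic_center x y)).
  - pose proof (Hfar w x ltac:(lra)). rewrite (metric_sym dist_eps_metric x w) in *. lra.
  - pose proof (Hfar w y ltac:(lra)). lra.
Qed.

Lemma ray_gromov_equiv_bounded g g' : is_ray d g p -> is_ray d g' p ->
  gromov_equiv d p (fun k => g (INR k)) (fun k => g' (INR k)) ->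
  forall t, 0 <= t -> d (g t) (g' t) <= 4 * delta.
Proof.
  pose proof hyperbolicity_constant_nonneg.
  intros Hg Hg' Hequiv t Ht. destruct (Hequiv t) as [N1 HN], (INR_eventually_ge t) as [N2 HN2].
  set (k := Nat.max N1 N2). specialize (HN k k ltac:(lia) ltac:(lia)).
  specialize (HN2 k ltac:(lia)).
  pose proof (ray_gromov_product p g t (INR k) Hg Ht (pos_INR k)) as Hgk.
  pose proof (ray_gromov_product p g' (INR k) t Hg' (pos_INR k) Ht) as Hgk'.
  rewrite (metric_refl Hd), Rminus_0_r in Hgk, Hgk'.
  rewrite Rmin_left in Hgk by lra. rewrite Rmin_right in Hgk' by lra.
  pose proof (gromov_product_chain _ _ _ _ Hgk HN) as Hgg'.
  pose proof (gromov_product_chain (g t) (g' (INR k)) (g' t) (t - delta) Hgg' ltac:(lra)) as Htt.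
  unfold gromov_product in Htt.
  rewrite (ray_dist_origin g p t Hg Ht), (ray_dist_origin g' p t Hg' Ht) in Htt. lra.
Qed.

Lemma subsequence_gromov_equiv_ray x : is_lim_seq (fun n => d p (x n)) p_infty ->
  exists g phi, is_ray d g p /\ (forall n, (n <= phi n)%nat) /\
    gromov_equiv d p (fun n => x (phi n)) (fun k => g (INR k)).
Proof.
  intros Hx.
  destruct (functional_choice (fun n G => is_geodesic d G p (x n))) as [G HG];
    [intros n; apply Hgeod|].
  destruct (geodesics_subconverge_to_ray Hd Hgeod Hproper G x HG Hx)
    as (g & phi & Hg & Hphi & Hlim).
  exists g, phi. split; [|split]; trivial. intros K.
  destruct (INR_eventually_ge (K + delta + 1)) as [k Hk].
  destruct (proj1 (lim_dist_0_iff Hd (fun n => G (phi n) (INR k)) (fun _ => g (INR k)))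
    (Hlim k) 1 Rlt_0_1) as [N1 HN1].
  apply (is_lim_seq_comp_ge_id _ _ phi Hphi) in Hx.
  destruct (proj1 (is_lim_seq_p_infty_ge _) Hx (INR k)) as [N2 HN2].
  exists (Nat.max k (Nat.max N1 N2)). intros n m Hn Hm.
  specialize (HN1 n ltac:(lia)). specialize (HN2 n ltac:(lia)).
  specialize (Hk k (le_n k)). set (w := G (phi n) (INR k)) in *.
  destruct (geodesic_dist_endpoints _ _ _ (INR k) (HG (phi n)) (conj (pos_INR k) HN2))
    as [Hpw Hwx].
  fold w in Hpw, Hwx.
  assert (Hxw : gp (x (phi n)) w = INR k)
    by (unfold gromov_product; rewrite (metric_sym Hd (x (phi n))); lra).
  pose proof (gromov_product_lipschitz (x (phi n)) w (g (INR k))) as Hxg.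
  pose proof (ray_gromov_product p g (INR k) (INR m) Hg (pos_INR k) (pos_INR m)) as Hgg.
  rewrite (metric_refl Hd), Rmin_left in Hgg by (apply le_INR; lia).
  replace K with (K + delta - delta) by ring.
  apply (gromov_product_chain _ (g (INR k))); lra.
Qed.

Lemma gromov_seq_equiv_ray u : gromov_seq d p u ->
  exists g, is_ray d g p /\ gromov_equiv d p u (fun k => g (INR k)).
Proof.
  intros Hu. destruct (subsequence_gromov_equiv_ray u (gromov_seq_escapes u Hu))
    as (g & phi & Hg & Hphi & Hequiv).
  exists g. split; trivial. apply (gromov_equiv_trans u (fun n => u (phi n))); trivial.
  apply gromov_equiv_sym, gromov_equiv_comp_l; trivial. apply gromov_seq_equiv, Hu.
Qed.

(** * The Gehring-Hayman properties *)

Lemma gromov_seq_of_gehring_hayman_along u :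
  cauchy_seq de u -> is_lim_seq (fun n => d p (u n)) p_infty ->
  gehring_hayman_along d de u -> gromov_seq d p u.
Proof.
  intros Hcauchy Hesc (C & HC & HGH). apply gromov_seq_equiv. intros K.
  destruct (geodesic_length_ge 1 Rlt_0_1) as (c & Hc & Hlen).
  destruct (Hcauchy (c * exp (- eps * K) / C)) as [N1 HN1].
  { apply Rdiv_lt_0_compat; [apply Rmult_lt_0_compat; trivial; apply exp_pos|lra]. }
  destruct (proj1 (is_lim_seq_p_infty_ge _) Hesc (K + 1)) as [N2 HN2].
  exists (Nat.max N1 N2). intros n m Hn Hm.
  specialize (HN1 n m ltac:(lia) ltac:(lia)). specialize (HN2 n ltac:(lia)).
  destruct (Rle_dec 1 (d (u n) (u m))) as [Hfar|Hnear].
  - destruct (Hgeod (u n) (u m)) as [g Hg].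
    pose proof (Rbar_le_trans _ _ _ (Hlen _ _ g Hg Hfar) (HGH n m g Hg)) as H. simpl in H.
    apply Rlt_le, gromov_product_gt_of_visual, (Rmult_lt_reg_l c); trivial.
    eapply Rle_lt_trans; [exact H|].
    replace (c * exp (- eps * K)) with (C * (c * exp (- eps * K) / C)) by (field; lra).
    apply Rmult_lt_compat_l; [lra|exact HN1].
  - pose proof (gromov_product_ge_dist (u n) (u m)). lra.
Qed.

Lemma GH_boundary_points_along xi : GH_boundary_points d de -> boundary_seq de xi ->
  gehring_hayman_along d de xi.
Proof.
  intros HGH Hxi. apply (HGH xi Hxi xi), (cauchy_seq_lim_dist_to_bpt dist_eps_metric), Hxi.
Qed.

Lemma GH_boundary_points_boundary_seq_gromov xi : GH_boundary_points d de ->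
  boundary_seq de xi -> gromov_seq d p xi.
Proof.
  intros HGH Hxi. apply gromov_seq_of_gehring_hayman_along.
  - apply Hxi.
  - apply boundary_seq_escapes, Hxi.
  - apply GH_boundary_points_along; trivial.
Qed.

Lemma GH_boundary_points_GH_gromov_seq : GH_boundary_points d de -> GH_gromov_seq d de p.
Proof.
  intros HGH u Hu. apply GH_boundary_points_along, gromov_seq_boundary; trivial.
Qed.

Lemma GH_boundary_points_Phi_bijective : GH_boundary_points d de -> Phi_bijective d de p.
Proof.
  intros HGH. split.
  - intros g g' Hg Hg' Hlim. exists (4 * delta).
    apply (ray_gromov_equiv_bounded g g' Hg Hg'), gromov_equiv_of_interleave.
    apply (GH_boundary_points_boundary_seq_gromov _ HGH).
    apply (boundary_seq_interleave dist_eps_metric); trivial. apply (ray_boundary_seq p), Hg.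
  - intros xi Hxi.
    destruct (gromov_seq_equiv_ray xi (GH_boundary_points_boundary_seq_gromov xi HGH Hxi))
      as (g & Hg & Hequiv).
    exists g. split; trivial. apply (lim_dist_to_bpt_0 dist_eps_metric); [apply Hxi|].
    apply (gromov_equiv_dist_eps_small (fun k => g (INR k)) xi), gromov_equiv_sym, Hequiv.
Qed.

Lemma GH_gromov_seq_visual_le u v : GH_gromov_seq d de p -> gromov_equiv d p u v ->
  exists c, 0 < c /\ forall n, 1 <= d (u n) (v n) -> c * visual (u n) (v n) <= de (u n) (v n).
Proof.
  intros HGH Huv. assert (Hvv : gromov_equiv d p v v)
    by (apply (gromov_equiv_trans v u); trivial; apply gromov_equiv_sym, Huv).
  destruct (HGH (interleave u v)) as (C & HC & Hle).
  { apply gromov_seq_equiv, (gromov_equiv_trans _ v);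
      [|apply gromov_equiv_sym]; apply gromov_equiv_interleave; trivial. }
  destruct (geodesic_length_ge 1 Rlt_0_1) as (c & Hc & Hge).
  exists (c / C). split; [apply Rdiv_lt_0_compat; lra|]. intros n Hfar.
  destruct (Hgeod (u n) (v n)) as [g Hg]. specialize (Hle (2 * n)%nat (S (2 * n)) g).
  rewrite interleave_even, interleave_odd in Hle.
  pose proof (Rbar_le_trans _ _ _ (Hge _ _ g Hg Hfar) (Hle Hg)) as H. simpl in H.
  apply Rmult_le_reg_l with C; [lra|].
  replace (C * (c / C * visual (u n) (v n))) with (c * visual (u n) (v n)) by (field; lra).
  exact H.
Qed.

(* Subsequences converge to two points of the Gromov boundary, which have equal
   images under [Phi], hence coincide. *)
Lemma far_pairs_gromov_equiv_subsequence x y : Phi_bijective d de p ->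
  (forall n : nat, 1 <= d (x n) (y n)) -> is_lim_seq (fun n => de (x n) (y n)) 0 ->
  exists phi, (forall n, (n <= phi n)%nat) /\
    gromov_equiv d p (fun n => x (phi n)) (fun n => y (phi n)).
Proof.
  intros [Hinj _] Hfar Hlim.
  pose proof (far_pairs_escape x y 1 Rlt_0_1 Hfar Hlim) as Hx.
  destruct (subsequence_gromov_equiv_ray x Hx) as (g & phi & Hg & Hphi & Hxg).
  assert (Hy : is_lim_seq (fun n => d p (y n)) p_infty).
  { apply (far_pairs_escape y x 1 Rlt_0_1); [intros n; rewrite (metric_sym Hd); auto|].
    apply (lim_dist_0_sym dist_eps_metric), Hlim. }
  destruct (subsequence_gromov_equiv_ray (fun n => y (phi n))) as (g' & psi & Hg' & Hpsi & Hyg').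
  { apply (is_lim_seq_comp_ge_id _ _ phi Hphi Hy). }
  assert (Hchi : forall n, (n <= phi (psi n))%nat)
    by (intros n; etransitivity; [apply Hpsi|apply Hphi]).
  apply (gromov_equiv_comp_l _ _ psi Hpsi) in Hxg.
  exists (fun n => phi (psi n)). split; trivial.
  destruct (Hinj g g' Hg Hg') as [C HC].
  { apply (lim_dist_0_trans dist_eps_metric _ (fun n => x (phi (psi n))));
      [apply gromov_equiv_lim_dist_eps, gromov_equiv_sym, Hxg|].
    apply (lim_dist_0_trans dist_eps_metric _ (fun n => y (phi (psi n))));
      [apply (is_lim_seq_comp_ge_id _ _ _ Hchi Hlim)|].
    apply gromov_equiv_lim_dist_eps, Hyg'. }
  apply (gromov_equiv_trans _ _ _ Hxg), (gromov_equiv_trans _ (fun k => g' (INR k)));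
    [apply (bounded_rays_gromov_equiv p g g' C Hg HC)|apply gromov_equiv_sym, Hyg'].
Qed.

Lemma GH_gromov_seq_GH_theorem :
  Phi_bijective d de p -> GH_gromov_seq d de p -> GH_theorem d de.
Proof.
  intros Hbij HGH. set (c := fun n : nat => / (INR n + 1)).
  assert (Hc : forall n, 0 < c n).
  { intros n. apply Rinv_0_lt_compat. pose proof (pos_INR n). lra. }
  assert (Hc0 : is_lim_seq c 0).
  { apply is_lim_seq_ext with (fun n => / INR (S n)); [intros n; rewrite S_INR; reflexivity|].
    apply (is_lim_seq_incr_1 (fun n => / INR n)).
    apply (is_lim_seq_inv INR p_infty is_lim_seq_INR). discriminate. }
  apply NNPP. intros Hno.
  assert (Hbad : forall n, exists xy : X * X, 1 < d (fst xy) (snd xy) /\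
    de (fst xy) (snd xy) < c n * visual (fst xy) (snd xy)).
  { intros n. apply NNPP. intros H. apply Hno, (GH_theorem_of_visual_le (c n) 1 (Hc n) Rlt_0_1).
    intros x y Hxy. apply Rnot_lt_le. intros Hlt. apply H. exists (x, y). auto. }
  destruct (functional_choice _ Hbad) as [xy Hxy].
  destruct (far_pairs_gromov_equiv_subsequence (fun n => fst (xy n)) (fun n => snd (xy n)))
    as (phi & Hphi & Hequiv); trivial.
  { intros n. apply Rlt_le, Hxy. }
  { apply (is_lim_seq_le_le (fun _ => 0) _ c); [|apply is_lim_seq_const|exact Hc0].
    intros n. split; [apply (metric_nonneg dist_eps_metric)|].
    destruct (Hxy n) as [_ H]. specialize (Hc n).
    pose proof (visual_le_1 (fst (xy n)) (snd (xy n))). nra. }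
  destruct (GH_gromov_seq_visual_le _ _ HGH Hequiv) as (c' & Hc' & Hle).
  destruct (proj1 (is_lim_seq_0_nonneg c (fun n => Rlt_le _ _ (Hc n))) Hc0 c' Hc') as [N HN].
  specialize (HN (phi N) (Hphi N)). destruct (Hxy (phi N)) as [Hfar Hsmall].
  specialize (Hle N (Rlt_le _ _ Hfar)).
  pose proof (visual_pos (fst (xy (phi N))) (snd (xy (phi N)))).
  nra.
Qed.

Lemma GH_theorem_GH_boundary_points : GH_theorem d de -> GH_boundary_points d de.
Proof.
  intros (A & HA & HGH) xi _ u _. exists (Rmax 1 A). split; [apply Rmax_l|].
  intros n m g Hg. eapply Rbar_le_trans; [apply HGH, Hg|]. simpl.
  apply Rmult_le_compat_r; [apply (metric_nonneg dist_eps_metric)|apply Rmax_r].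
Qed.

(** * Uniformity *)

Lemma geodesic_min_length_le g x y t : is_geodesic d g x y -> 0 <= t <= d x y ->
  Rbar_le (Rbar_min (curve_length de g 0 t) (curve_length de g t (d x y)))
    (exp (eps * (2 * delta)) / eps * rho (g t)).
Proof.
  intros Hg Ht.
  apply Rbar_le_trans with (visual x y * exp (- eps * Rabs (t - geodesic_center x y)) / eps).
  - destruct (Rle_dec t (geodesic_center x y)).
    + eapply Rbar_le_trans; [apply Rbar_min_l|].
      rewrite Rabs_left1, Ropp_minus_distr by lra. apply geodesic_initial_length_le; trivial. lra.
    + eapply Rbar_le_trans; [apply Rbar_min_r|].
      rewrite Rabs_right by lra. apply geodesic_final_length_le; trivial. lra.
  - simpl. replace (exp (eps * (2 * delta)) / eps * rho (g t))
      with (exp (eps * (2 * delta)) * rho (g t) / eps) by (field; lra).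
    apply Rmult_le_compat_r; [apply Rlt_le, Rinv_0_lt_compat, Heps|].
    apply geodesic_center_visual_le; trivial.
Qed.

Lemma GH_theorem_geodesic_uniform : GH_theorem d de ->
  exists A, 0 < A /\ forall x y g, is_geodesic d g x y -> uniform_curve de A g 0 (d x y).
Proof.
  intros (A & HA & HGH). destruct dist_to_boundary_ge as (c & Hc & Hbd).
  set (B := exp (eps * (2 * delta)) / eps / c).
  assert (HB : 0 < B) by (repeat apply Rdiv_lt_0_compat; trivial; apply exp_pos).
  exists (A + B). split; [lra|]. intros x y g Hg. split; [|split].
  - apply is_geodesic_curve_dist_eps, Hg.
  - eapply Rbar_le_trans; [apply HGH, Hg|].
    destruct Hg as (-> & -> & _). simpl.
    pose proof (metric_nonneg dist_eps_metric x y). nra.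
  - intros t Ht. eapply Rbar_le_trans; [apply (geodesic_min_length_le g x y t Hg Ht)|].
    eapply Rbar_le_trans; [|apply Rbar_mult_le_compat_l; [lra|apply Hbd]].
    replace (exp (eps * (2 * delta)) / eps) with (B * c) by (unfold B; field; lra).
    simpl. pose proof (rho_pos (g t)). rewrite Rmult_assoc.
    apply Rmult_le_compat_r; [|lra]. apply Rmult_le_pos; lra.
Qed.

Context {M : R}.
Hypothesis Hstar : roughly_starlike d M.

Lemma roughly_starlike_near_ray : exists o, forall x, exists g t,
  is_ray d g o /\ 0 <= t /\ d x (g t) <= M + 1.
Proof.
  destruct Hstar as [o Ho]. exists o. intros x. destruct (Ho x) as (g & Hg & HM).
  exists g. apply NNPP. intros Hno.
  assert (HM' : Rbar_le (M + 1) M); [|simpl in HM'; lra].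
  eapply Rbar_le_trans; [|exact HM]. apply Glb_Rbar_correct. intros r (t & Ht & ->).
  apply Rnot_lt_le. intros Hlt. apply Hno. exists t. split; [|split]; trivial. lra.
Qed.

Lemma dist_eps_noncomplete : noncomplete de.
Proof.
  destruct roughly_starlike_near_ray as [o Ho]. destruct (Ho p) as (g & t & Hg & _).
  exists (fun k => g (INR k)). apply (ray_boundary_seq o), Hg.
Qed.

Lemma GH_theorem_uniform_space : GH_theorem d de -> uniform_space de.
Proof.
  intros HGH. split; [exact dist_eps_noncomplete|]. split; [exact dist_eps_locally_compact|].
  destruct (GH_theorem_geodesic_uniform HGH) as (A & HA & Hunif).
  exists A. split; trivial. intros x y. destruct (Hgeod x y) as [g Hg].
  exists g, 0, (d x y). split; [apply Hg|]. split; [apply Hg|]. apply Hunif, Hg.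
Qed.

Lemma dist_to_boundary_le :
  exists C, 0 < C /\ forall z, Rbar_le (dist_to_boundary de z) (C * rho z).
Proof.
  destruct roughly_starlike_near_ray as [o Ho].
  exists (2 / eps * exp (eps * (2 * d o p + 2 * (M + 1)))). split.
  { apply Rmult_lt_0_compat; [apply Rdiv_lt_0_compat; lra|apply exp_pos]. }
  intros z. destruct (Ho z) as (g & t & Hg & Ht & Hzt).
  pose proof (ray_boundary_seq o g Hg) as Hb.
  apply Rbar_le_trans with (dist_to_bpt de z (fun k => g (INR k))).
  { apply Glb_Rbar_correct. exists (fun k => g (INR k)). auto. }
  destruct (INR_eventually_ge t) as [N HN].
  apply (dist_to_bpt_le dist_eps_metric z _ _ N (proj1 Hb)). intros m Hm. specialize (HN m Hm).
  eapply Rle_trans; [apply dist_eps_le_visual|].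
  rewrite Rmult_assoc. apply Rmult_le_compat_l; [apply Rlt_le, Rdiv_lt_0_compat; lra|].
  unfold visual, rho_eps. rewrite <- exp_plus. apply exp_le_compat.
  pose proof (ray_gromov_product o g (INR m) t Hg (pos_INR m) Ht) as Hray.
  rewrite Rmin_right in Hray by lra.
  pose proof (gromov_product_lipschitz (g (INR m)) (g t) z) as Hlip.
  rewrite (gromov_product_sym (g (INR m)) z), (metric_sym Hd (g t)) in Hlip.
  pose proof (metric_tri Hd p o z) as Hpz. rewrite (metric_sym Hd p o) in Hpz.
  pose proof (metric_tri Hd o (g t) z) as Hoz.
  rewrite (ray_dist_origin g o t Hg Ht), (metric_sym Hd (g t)) in Hoz. nra.
Qed.

(* One step back by [N] indices gains a factor [q ^ N >= exp (eps * delta)], which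
   pays for the loss in the four-point condition. *)
Lemma growing_chain_visual_le K q r : 0 < K -> 1 < q -> 0 <= r -> exists K', 0 < K' /\
  forall (a : nat -> X) (s : nat -> R) m,
    (forall j, (j < m)%nat -> d (a j) (a (S j)) <= r) ->
    (forall j, (j <= m)%nat -> rho (a j) <= K * s j) ->
    (forall j, (j < m)%nat -> q * s j <= s (S j)) ->
    visual (a O) (a m) <= K' * s m.
Proof.
  intros HK Hq Hr.
  destruct (Pow_x_infinity q ltac:(rewrite Rabs_right; lra) (exp (eps * delta))) as [N0 HN0].
  set (N := S N0). specialize (HN0 N ltac:(unfold N; lia)).
  rewrite Rabs_right in HN0 by (apply Rle_ge, pow_le; lra).
  set (K0 := exp (eps * (INR N * r)) * K).
  assert (HK0 : 0 < K0) by (apply Rmult_lt_0_compat; trivial; apply exp_pos).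
  exists (exp (eps * delta) * K0).
  split; [apply Rmult_lt_0_compat; trivial; apply exp_pos|].
  intros a s m Hstep Hrho Hgrow.
  assert (Hs : forall j, (j <= m)%nat -> 0 < s j).
  { intros j Hj. specialize (Hrho j Hj). pose proof (rho_pos (a j)). nra. }
  assert (Hnear : forall i k, (k <= N)%nat -> (i + k <= m)%nat ->
    visual (a i) (a (i + k)%nat) <= K0 * s (i + k)%nat).
  { intros i k Hk Hi. set (j := (i + k)%nat). rewrite visual_sym.
    eapply Rle_trans; [apply (visual_lipschitz (a j) (a j))|].
    rewrite visual_self. unfold K0. rewrite Rmult_assoc.
    apply Rmult_le_compat; [apply Rlt_le, exp_pos|apply rho_nonneg| |apply Hrho, Hi].
    apply exp_le_compat, Rmult_le_compat_l; [lra|]. rewrite (metric_sym Hd).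
    eapply Rle_trans; [apply (chain_dist_le Hd a r m i k Hstep Hi)|].
    apply Rmult_le_compat_r; trivial. apply le_INR, Hk. }
  assert (Hall : forall j, (j <= m)%nat -> visual (a O) (a j) <= exp (eps * delta) * K0 * s j);
    [|apply Hall, le_n].
  intros j. induction j as [j IH] using lt_wf_ind. intros Hj. rewrite Rmult_assoc.
  destruct (Nat.le_gt_cases j N) as [Hle|Hgt].
  - apply (visual_quasi_ultrametric _ (a j)); [apply (Hnear O j Hle Hj)|].
    pose proof (Hnear j O ltac:(lia) ltac:(lia)) as H. rewrite Nat.add_0_r in H. exact H.
  - replace j with (j - N + N)%nat by lia. set (i := (j - N)%nat).
    apply (visual_quasi_ultrametric _ (a i)); [|apply Hnear; lia].
    eapply Rle_trans; [apply IH; lia|].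
    rewrite (Rmult_comm _ K0), Rmult_assoc. apply Rmult_le_compat_l; [lra|].
    eapply Rle_trans; [|apply (geometric_growth s q m i N); trivial; [lra|lia]].
    apply Rmult_le_compat_r; [apply Rlt_le, Hs; lia|lra].
Qed.

Lemma half_chain_visual_le kappa C r : 0 < kappa -> 0 < C -> 0 <= r -> exists K, 0 < K /\
  forall (a : nat -> X) (l : nat -> R) m,
    (forall i, (i < m)%nat -> d (a i) (a (S i)) <= r) ->
    (forall i, (i <= m)%nat -> kappa * rho (a i) <= l i) ->
    (forall i, (i <= m)%nat -> sumlt l i <= C * rho (a i)) ->
    visual (a O) (a m) <= K * sumlt l (S m).
Proof.
  intros Hkappa HC Hr. assert (Hq : 0 < kappa / C) by (apply Rdiv_lt_0_compat; trivial).
  destruct (growing_chain_visual_le (/ kappa) (1 + kappa / C) r) as (K & HK & Hchain);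
    [apply Rinv_0_lt_compat, Hkappa|lra|exact Hr|].
  exists K. split; trivial. intros a l m Hstep Hl Hsum.
  assert (Hlpos : forall i, (i <= m)%nat -> 0 < l i).
  { intros i Hi. specialize (Hl i Hi). pose proof (rho_pos (a i)). nra. }
  apply (Hchain a (fun j => sumlt l (S j)) m Hstep).
  - intros j Hj. apply Rmult_le_reg_l with kappa; trivial.
    rewrite <- Rmult_assoc, Rinv_r, Rmult_1_l by lra.
    eapply Rle_trans; [apply Hl, Hj|]. simpl.
    assert (0 <= sumlt l j) by (apply sumlt_nonneg; intros k Hk; apply Rlt_le, Hlpos; lia). lra.
  - intros j Hj. specialize (Hl (S j) Hj). specialize (Hsum (S j) Hj).
    change (sumlt l (S (S j))) with (sumlt l (S j) + l (S j)).
    assert (kappa / C * sumlt l (S j) <= kappa / C * (C * rho (a (S j))))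
      by (apply Rmult_le_compat_l; lra).
    replace (kappa / C * (C * rho (a (S j)))) with (kappa * rho (a (S j))) in * by (field; lra).
    lra.
Qed.

(* The chain is cut where half of its length is reached; [half_chain_visual_le]
   applies to the first half and to the reversed second half. *)
Lemma uniform_chain_visual_le kappa C r : 0 < kappa -> 0 < C -> 0 <= r -> exists K, 0 < K /\
  forall (a : nat -> X) (l : nat -> R) n, (0 < n)%nat ->
    (forall i, (i < n)%nat -> d (a i) (a (S i)) <= r) ->
    (forall i, (i < n)%nat -> kappa * rho (a i) <= l i /\ kappa * rho (a (S i)) <= l i) ->
    (forall k, (k <= n)%nat -> Rmin (sumlt l k) (sumlt l n - sumlt l k) <= C * rho (a k)) ->
    visual (a O) (a n) <= K * sumlt l n.
Proof.
  intros Hkappa HC Hr. destruct (half_chain_visual_le kappa C r) as (K & HK & Hhalf); trivial.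
  exists (exp (eps * delta) * (exp (eps * r) * K)).
  split; [repeat apply Rmult_lt_0_compat; trivial; apply exp_pos|].
  intros a l n Hn Hstep Hl Hmin. set (L := sumlt l n) in *.
  assert (Hlpos : forall i, (i < n)%nat -> 0 <= l i).
  { intros i Hi. destruct (Hl i Hi) as [H _]. pose proof (rho_pos (a i)). nra. }
  assert (Hmono : forall i j, (i <= j <= n)%nat -> sumlt l i <= sumlt l j)
    by (intros i j; apply sumlt_monotone; trivial).
  assert (HL : 0 <= L) by (apply sumlt_nonneg, Hlpos).
  destruct (discrete_intermediate_value (sumlt l) n (L / 2) Hn) as (m & Hm & Hcut).
  { simpl. fold L. lra. }
  assert (Hfirst : visual (a O) (a m) <= K * L).
  { apply Rle_trans with (K * sumlt l (S m)).
    - apply Hhalf; [intros; apply Hstep; lia|intros; apply Hl; lia|].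
      intros i Hi. specialize (Hmin i ltac:(lia)). pose proof (Hmono i m ltac:(lia)).
      rewrite Rmin_left in Hmin; lra.
    - apply Rmult_le_compat_l; [lra|]. apply Hmono. lia. }
  assert (Hsecond : visual (a n) (a (S m)) <= K * L).
  { set (m' := (n - S m)%nat). set (l' := fun i => l (n - S i)%nat).
    assert (Hsum : forall i, (i <= n)%nat -> sumlt l' i = L - sumlt l (n - i))
      by (intros; apply sumlt_rev_partial; trivial).
    replace (a n) with (a (n - 0)%nat) by (f_equal; lia).
    replace (S m) with (n - m')%nat by lia.
    apply Rle_trans with (K * sumlt l' (S m')).
    - apply (Hhalf (fun i => a (n - i)%nat)).
      + intros i Hi. rewrite (metric_sym Hd). replace (n - i)%nat with (S (n - S i)) by lia.
        apply Hstep. lia.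
      + intros i Hi. unfold l'. replace (n - i)%nat with (S (n - S i)) by lia. apply Hl. lia.
      + intros i Hi. rewrite Hsum by lia. specialize (Hmin (n - i)%nat ltac:(lia)).
        pose proof (Hmono (S m) (n - i)%nat ltac:(lia)). rewrite Rmin_right in Hmin; lra.
    - apply Rmult_le_compat_l; [lra|]. rewrite Hsum by lia.
      assert (0 <= sumlt l (n - S m')) by (apply sumlt_nonneg; intros; apply Hlpos; lia). lra. }
  rewrite !Rmult_assoc. assert (HKL : 0 <= K * L) by (apply Rmult_le_pos; lra).
  assert (Hexp : 1 <= exp (eps * r)) by (rewrite <- exp_0; apply exp_le_compat; nra).
  apply (visual_quasi_ultrametric _ (a (S m))); [|rewrite visual_sym; nra].
  eapply Rle_trans; [apply (visual_lipschitz _ (a m))|].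
  apply Rmult_le_compat; [apply Rlt_le, exp_pos|apply Rlt_le, visual_pos| |exact Hfirst].
  apply exp_le_compat, Rmult_le_compat_l; [lra|apply Hstep, Hm].
Qed.

Lemma uniform_curve_min_le A : 0 < A -> exists C, 0 < C /\
  forall g a b t, uniform_curve de A g a b -> a <= t <= b ->
    Rbar_le (Rbar_min (curve_length de g a t) (curve_length de g t b)) (C * rho (g t)).
Proof.
  intros HA. destruct dist_to_boundary_le as (C & HC & Hbd).
  exists (A * C). split; [apply Rmult_lt_0_compat; trivial|]. intros g a b t Hunif Ht.
  eapply Rbar_le_trans; [apply Hunif, Ht|]. rewrite Rmult_assoc.
  apply (Rbar_mult_le_compat_l A _ (C * rho (g t))); trivial.
Qed.

Lemma uniform_curve_visual_le A : 0 < A -> exists K, 0 < K /\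
  forall g a b, uniform_curve de A g a b -> 1 <= d (g a) (g b) ->
    visual (g a) (g b) <= K * de (g a) (g b).
Proof.
  intros HA. destruct (dist_eps_ge_far 1 Rlt_0_1) as (kappa & Hkappa & Hfar).
  destruct (uniform_curve_min_le A HA) as (C & HC & Hmin).
  destruct (uniform_chain_visual_le kappa C (5 * 1)) as (K & HK & Hchain); trivial; [lra|].
  exists (K * A). split; [apply Rmult_lt_0_compat; trivial|]. intros g a b Hunif Hab.
  destruct (curve_chain Hd g a b 1) as (n & t & Ht & Hsteps);
    [apply is_curve_of_dist_eps, Hunif|lra|exact Hab|].
  set (c := fun u v => de (g u) (g v)).
  pose proof Ht as (Ha & Hb & _).
  assert (Hn : (0 < n)%nat).
  { destruct n; [|lia]. rewrite <- Hb, Ha, (metric_refl Hd) in Hab. lra. }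
  assert (Hlen : partition_sum c n t <= A * de (g a) (g b))
    by (apply (Rbar_le_trans _ _ _ (partition_sum_le_sup c _ _ _ _ Ht) (proj1 (proj2 Hunif)))).
  rewrite <- Ha, <- Hb at 1. apply Rle_trans with (K * partition_sum c n t);
    [|rewrite Rmult_assoc; apply Rmult_le_compat_l; lra].
  apply (Hchain (fun i => g (t i))); trivial.
  - intros i Hi. apply Hsteps, Hi.
  - intros i Hi. destruct (Hsteps i Hi) as [Hlow _]. split; [apply Hfar, Hlow|].
    unfold c. rewrite (metric_sym dist_eps_metric). apply Hfar.
    rewrite (metric_sym Hd). exact Hlow.
  - intros k Hk. change (Rmin (partition_sum c k t) (partition_sum c n t - partition_sum c k t)
      <= C * rho (g (t k))).
    rewrite <- partition_sum_suffix by exact Hk.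
    pose proof (partition_sum_le_sup c _ _ _ _ (partition_prefix _ _ _ _ k Ht Hk)) as Hprefix.
    pose proof (partition_sum_le_sup c _ _ _ _ (partition_suffix _ _ _ _ k Ht Hk)) as Hsuffix.
    assert (Htk : a <= t k <= b).
    { rewrite <- Ha, <- Hb. split; apply (partition_le a b n t); trivial; lia. }
    generalize (Hmin g a b (t k) Hunif Htk). apply Rbar_min_case; intros Hle.
    + eapply Rle_trans; [apply Rmin_l|exact (Rbar_le_trans _ _ _ Hprefix Hle)].
    + eapply Rle_trans; [apply Rmin_r|exact (Rbar_le_trans _ _ _ Hsuffix Hle)].
Qed.

Lemma uniform_space_GH_theorem : uniform_space de -> GH_theorem d de.
Proof.
  intros (_ & _ & A & HA & Hunif). destruct (uniform_curve_visual_le A HA) as (K & HK & Hle).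
  apply (GH_theorem_of_visual_le (/ K) 1); [apply Rinv_0_lt_compat, HK|lra|].
  intros x y Hxy. destruct (Hunif x y) as (g & a & b & <- & <- & Hg).
  apply Rmult_le_reg_l with K; trivial. rewrite <- Rmult_assoc, Rinv_r, Rmult_1_l by lra.
  apply Hle; trivial. lra.
Qed.

End Uniformization.

Theorem theorem1p3 (X : Type) (d : X -> X -> R) (delta M : R)
  (Hdelta : 0 <= delta) (HM : 0 <= M)
  (Hhyp : gromov_hyperbolic d delta) (Hstar : roughly_starlike d M)
  (p : X) (eps : R) (Heps : 0 < eps) :
  let de := dist_eps d p eps in
  (GH_boundary_points d de <->
     (Phi_bijective d de p /\ GH_gromov_seq d de p)) /\
  ((Phi_bijective d de p /\ GH_gromov_seq d de p) <-> GH_theorem d de) /\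
  (GH_theorem d de <-> uniform_space de).
Proof.
  intros de. destruct Hhyp as (Hd & _ & Hproper & Hgeod & Hfour).
  assert (Hmin : forall x y z, Rmin (gromov_product d p x y) (gromov_product d p y z) - delta <=
    gromov_product d p x z) by (intros; apply Rge_le, Hfour).
  assert (H12 : GH_boundary_points d de -> Phi_bijective d de p /\ GH_gromov_seq d de p).
  { intros H. split.
    - exact (GH_boundary_points_Phi_bijective Hd Heps Hgeod Hproper Hmin H).
    - exact (GH_boundary_points_GH_gromov_seq Hd Heps Hgeod H). }
  assert (H23 : Phi_bijective d de p /\ GH_gromov_seq d de p -> GH_theorem d de).
  { intros [Hbij Hseq]. exact (GH_gromov_seq_GH_theorem Hd Heps Hgeod Hproper Hmin Hbij Hseq). }
  assert (H31 : GH_theorem d de -> GH_boundary_points d de)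
    by exact (GH_theorem_GH_boundary_points Hd Heps Hgeod).
  split; [|split]; split; auto.
  - exact (GH_theorem_uniform_space Hd Heps Hgeod Hproper Hmin Hstar).
  - exact (uniform_space_GH_theorem Hd Heps Hgeod Hmin Hstar).
Qed.
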